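(* Let $(x_k)_{k\ge 0}$ be a uniformly ergodic Markov chain on a Borel space $\mathcal X$ with transition kernel $P$, unique stationary distribution $\pi$, and $x_0\sim\pi$, and suppose the chain is reversible with respect to $\pi$, i.e. $P^*=P$. Let $A:\mathcal X\to\mathbb R^{d\times d}$ and $b:\mathcal X\to\mathbb R^d$ satisfy $A_{\max}:=\sup_x\|A(x)\|\le 1$ and $b_{\max}:=\sup_x\|b(x)\|<\infty$, and suppose $\bar A:=\mathbb E_{\pi}[A(x)]$ is Hurwitz. Let $\alpha\in(0,1)$ satisfy $\alpha\tau_\alpha<\frac{0.05}{95\gamma_{\max}}$. Let $\theta^*$ be the solution of $\bar A\theta+\bar b=0$, $\bar b:=\mathbb E_\pi[b(x)]$, and define $$\Xi:=(I-P^*+\Pi)^{-1}(P^*-\Pi)D(I-\Pi\bar D),\qquad \upsilon:=(I-P^*+\Pi)^{-1}(P^*-\Pi)(A\theta^*+b),\qquad B^{(i)}:=-\pi\bar D\,\Xi^{i-1}\upsilon,\quad i=1,2,\ldots$$ Then for each $i=1,2,\ldots$, $$\|B^{(i)}\|\le\Big(C\cdot\frac{1-\gamma^\star(P)}{\gamma^\star(P)}\Big)^i$$ for some number $C\equiv C(A,b,\pi)>0$ that depends only on $A,b,\pi$ (not on other properties of $P$), where $\gamma^\star(P)$ is the absolute spectral gap of $P$.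
   Context: Norms: $\|\cdot\|$ is the Euclidean norm for vectors and the spectral norm for matrices. Uniformly ergodic means $\sup_{x\in\mathcal X}\|P^n(x,\cdot)-\pi\|_{TV}\to0$ as $n\to\infty$. $\mathcal X$ is a (standard) Borel space; $A,b$ are deterministic measurable functions. (The $B^{(i)}$ are the coefficients in the expansion in $\alpha$ of the asymptotic bias of the iteration $\theta_{k+1}=\theta_k+\alpha(A(x_k)\theta_k+b(x_k))$.) Lyapunov constants: Hurwitz means all eigenvalues have strictly negative real parts. $\Gamma$ is the symmetric positive definite matrix with $\bar A^\top\Gamma+\Gamma\bar A=-I$; $\gamma_{\max}$ is its maximum eigenvalue. $\bar A$ is invertible, so $\theta^*$ is unique. Mixing time: for $\epsilon\in(0,1)$, $\tau_\epsilon$ is the smallest number $\tau_\epsilon\ge1$ such that for all $x\in\mathcal X$ and all $k\ge\tau_\epsilon$: $\|\mathbb E[A(x_k)\mid x_0=x]-\bar A\|\le\epsilon A_{\max}$ and $\|\mathbb E[b(x_k)\mid x_0=x]-\bar b\|\le\epsilon b_{\max}$. $\tau_\alpha$ is this quantity with $\epsilon=\alpha$. Operators: $L^2(\pi)$ is the Hilbert space of ($\pi$-a.e. classes of) measurable $f:\mathcal X\to\mathbb R^d$ with $\|f\|_{L^2(\pi)}^2=\int\|f(x)\|^2\pi(dx)<\infty$. $\pi f=\int f\,d\pi$. $P$ acts by $(Pf)(x)=\int P(x,dy)f(y)$ and $P^*$ is its adjoint on $L^2(\pi)$. $\Pi=1\otimes\pi$, i.e. $(\Pi f)(x)=\pi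 f$. $(Df)(x)=A(x)f(x)$, $(\bar Df)(x)=\bar A^{-1}A(x)f(x)$. $A\theta^*+b$ is the function $x\mapsto A(x)\theta^*+b(x)$; $\pi\bar D$ denotes $f\mapsto\pi(\bar Df)$. Absolute spectral gap: viewing $P$ as an operator on scalar (complex-valued) square-integrable functions, $\operatorname{Spec}(P)=\{\lambda\in\mathbb C\setminus\{0\}:(\lambda I-P)^{-1}\text{ does not exist as a bounded linear operator}\}$, and $\gamma^\star(P)=1-\sup\{|\lambda|:\lambda\in\operatorname{Spec}(P),\lambda\ne1\}$ if the eigenvalue $1$ has multiplicity $1$ (with the supremum of the empty set equal to $0$), and $\gamma^\star(P)=0$ otherwise. Under the hypotheses, $\gamma^\star(P)>0$. *)

(* Defs.v *)
From HB Require Import structures.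
From mathcomp Require Import all_boot all_order all_algebra.
From mathcomp Require Import complex.
From mathcomp Require Import all_classical all_reals all_analysis.

Set Implicit Arguments.
Unset Strict Implicit.
Unset Printing Implicit Defensive.

Import Order.TTheory GRing.Theory Num.Theory.
Import numFieldNormedType.Exports.

Local Open Scope classical_set_scope.
Local Open Scope ring_scope.

(* The library norm on matrices is the entrywise maximum, so the Euclidean and
   spectral norms are defined here. *)
Definition enorm (R : realType) (d : nat) (v : 'cV[R]_d) : R :=
  Num.sqrt (\sum_(i < d) v i 0 ^+ 2).

Definition specnorm (R : realType) (d : nat) (M : 'M[R]_d) : R :=
  sup [set enorm (M *m v) | v in [set v : 'cV[R]_d | enorm v <= 1]].

Definition hurwitz (R : realType) (d : nat) (M : 'M[R]_d) : Prop :=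
  forall z : R[i], eigenvalue (map_mx (real_complex R) M) z -> complex.Re z < 0.

Definition posdef (R : realType) (d : nat) (M : 'M[R]_d) : Prop :=
  M^T = M /\ forall v : 'cV[R]_d, v != 0 -> 0 < (v^T *m M *m v) 0 0.

Definition lyapunov (R : realType) (d : nat) (Ab Gamma : 'M[R]_d) : Prop :=
  posdef Gamma /\ Ab^T *m Gamma + Gamma *m Ab = - 1%:M.

Definition max_eigenvalue (R : realType) (d : nat) (M : 'M[R]_d) (g : R) : Prop :=
  eigenvalue M g /\ forall h, eigenvalue M h -> h <= g.

(* A measurable space isomorphic to a Borel subset of the line. *)
Definition borel_space (R : realType) (dT : measure_display)
    (T : measurableType dT) : Prop :=
  exists phi : T -> R, [/\ measurable_fun setT phi, injective phi &
    forall U, measurable U -> measurable (phi @` U)].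

Section markov_chain.
Context {R : realType} {dT : measure_display} {T : measurableType dT}.
Implicit Types (P : R.-pker T ~> T) (pi : probability T R).

Fixpoint kpow P (n : nat) : R.-spker T ~> T :=
  if n is m.+1 then mkcomp_noparam P (kpow P m) else kdirac (@measurable_id _ T setT).

Definition stationary P pi : Prop :=
  forall U, measurable U -> (\int[pi]_x P x U = pi U)%E.

Definition unique_stationary P pi : Prop :=
  stationary P pi /\
  forall mu : probability T R, stationary P mu ->
    forall U, measurable U -> mu U = pi U.

Definition tv_dist (mu nu : {measure set T -> \bar R}) : \bar R :=
  ereal_sup [set `|mu U - nu U|%E | U in [set U : set T | measurable U]].

Definition uniformly_ergodic P pi : Prop :=
  ereal_sup (range (fun x => tv_dist (kpow P n x) pi)) @[n --> \oo] --> 0%E.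

(* Initial law [pi] and Markov property with respect to the natural
   filtration, tested on cylinder events of the past. *)
Definition is_markov_chain P pi (dO : measure_display) (Omega : measurableType dO)
    (Pr : probability Omega R) (X : nat -> {RV Pr >-> T}) : Prop :=
  (forall U, measurable U -> Pr (X 0%N @^-1` U) = pi U) /\
  forall (U : nat -> set T) (k : nat), (forall j, measurable (U j)) ->
    Pr (\bigcap_(j in `I_k.+2) (X j @^-1` U j)) =
    (\int[Pr]_(w in \bigcap_(j in `I_k.+1) (X j @^-1` U j)) P (X k w) (U k.+1))%E.

End markov_chain.

Section coefficients.
Context {R : realType} {dT : measure_display} {T : measurableType dT} {d : nat}.
Variables (A : T -> 'M[R]_d) (b : T -> 'cV[R]_d).

Definition mmean (mu : {measure set T -> \bar R}) : 'M[R]_d :=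
  \matrix_(i, j) (\int[mu]_x A x i j).

Definition vmean (mu : {measure set T -> \bar R}) (f : T -> 'cV[R]_d) : 'cV[R]_d :=
  \col_i (\int[mu]_x f x i 0).

Definition mmeasurable : Prop := forall i j, measurable_fun setT (fun x => A x i j).

Definition vmeasurable (f : T -> 'cV[R]_d) : Prop :=
  forall i, measurable_fun setT (fun x => f x i 0).

Definition Amax : \bar R := ereal_sup (range (fun x => (specnorm (A x))%:E)).
Definition bmax : \bar R := ereal_sup (range (fun x => (enorm (b x))%:E)).

(* E[f(x_k) | x_0 = x] is the integral of f against P^k(x, .). *)
Definition mixed (P : R.-pker T ~> T) (pi : probability T R) (eps : R) (tau : nat) : Prop :=
  forall (x : T) (k : nat), (tau <= k)%N ->
    ((specnorm (mmean (kpow P k x) - mmean pi))%:E <= eps%:E * Amax)%E /\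
    ((enorm (vmean (kpow P k x) b - vmean pi b))%:E <= eps%:E * bmax)%E.

Definition is_mixing_time (P : R.-pker T ~> T) (pi : probability T R) (eps : R)
    (tau : nat) : Prop :=
  [/\ (1 <= tau)%N, mixed P pi eps tau &
      forall t, (1 <= t)%N -> mixed P pi eps t -> (tau <= t)%N].

End coefficients.

(* Elements of L^2 are represented by functions, equality in L^2 being equality
   almost everywhere; an operator on L^2 is a map on functions restricted to the
   set [L] of representatives.  Linearity and boundedness below, both up to null
   sets, make a bounded operator compatible with equality almost everywhere. *)
Section L2_operators.
Context {R : realType} {dT : measure_display} {T : measurableType dT}.
Variable pi : probability T R.

Definition L2norm (V : Type) (nu : V -> R) (f : T -> V) : R :=
  fine (Lnorm pi 2%:E (fun x => (nu (f x))%:E)).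

Context {K : pzRingType} {V : lmodType K}.
Variables (L : set (T -> V)) (N : (T -> V) -> R).
Implicit Types S Q : (T -> V) -> (T -> V).

Definition bounded_operator S : Prop :=
  [/\ forall f, L f -> L (S f),
      forall (a : K) f g, L f -> L g -> S (a *: f + g) = a *: S f + S g %[ae pi] &
      exists M : R, forall f, L f -> N (S f) <= M * N f].

Definition is_bounded_inverse Q S : Prop :=
  bounded_operator S /\
  forall f, L f -> S (Q f) = f %[ae pi] /\ Q (S f) = f %[ae pi].

(* The inverse of [Q] when it exists (it is then unique up to null sets). *)
Definition bounded_inverse Q : (T -> V) -> (T -> V) :=
  xget (id : (T -> V) -> (T -> V)) [set S | is_bounded_inverse Q S].

Definition is_adjoint (ip : (T -> V) -> (T -> V) -> R) Q S : Prop :=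
  (forall f, L f -> L (S f)) /\
  forall f g, L f -> L g -> ip (Q f) g = ip f (S g).

(* The adjoint of [Q] when it exists (it is then unique up to null sets). *)
Definition adjoint (ip : (T -> V) -> (T -> V) -> R) Q : (T -> V) -> (T -> V) :=
  xget (id : (T -> V) -> (T -> V)) [set S | is_adjoint ip Q S].

End L2_operators.

Section absolute_spectral_gap.
Context {R : realType} {dT : measure_display} {T : measurableType dT}.
Variables (P : R.-pker T ~> T) (pi : probability T R).

Definition cL2 : set (T -> R[i]) :=
  [set f : T -> R[i] | [/\ measurable_fun setT (fun x => complex.Re (f x)),
               measurable_fun setT (fun x => complex.Im (f x)) &
               finite_norm pi 2%:E (fun x => Normc.normc (f x))]].

Definition cP (f : T -> R[i]) : T -> R[i] := fun x =>
  Complex (\int[P x]_y complex.Re (f y)) (\int[P x]_y complex.Im (f y)).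

Definition Spec : set R[i] :=
  [set z | z != 0 /\
    ~ exists S, is_bounded_inverse pi cL2 (L2norm pi (@Normc.normc R))
                  (fun f => z *: f - cP f) S].

(* The eigenspace of the eigenvalue 1 is one-dimensional. *)
Definition one_multiplicity_one : Prop :=
  exists f, [/\ cL2 f, cP f = f %[ae pi], ~ (f = cst 0 %[ae pi]) &
    forall g, cL2 g -> cP g = g %[ae pi] -> exists c : R[i], g = c *: f %[ae pi]].

Definition spectral_gap : R :=
  if `[< one_multiplicity_one >] then
    1 - sup [set Normc.normc z | z in Spec `&` [set z | z != 1]]
  else 0.

End absolute_spectral_gap.

Section bias_coefficients.
Context {R : realType} {dT : measure_display} {T : measurableType dT} {d : nat}.
Variables (P : R.-pker T ~> T) (pi : probability T R).

Definition vL2 : set (T -> 'cV[R]_d) :=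
  [set f | vmeasurable f /\ finite_norm pi 2%:E (fun x => enorm (f x))].

Definition vdot (f g : T -> 'cV[R]_d) : R :=
  \int[pi]_x (\sum_(i < d) f x i 0 * g x i 0).

Definition vP (f : T -> 'cV[R]_d) : T -> 'cV[R]_d := fun x => vmean (P x) f.

Definition vPadj : (T -> 'cV[R]_d) -> T -> 'cV[R]_d := adjoint vL2 vdot vP.

(* P^* = P *)
Definition reversible : Prop := is_adjoint vL2 vdot vP vP.

Definition vPi (f : T -> 'cV[R]_d) : T -> 'cV[R]_d := cst (vmean pi f).

Variables (A : T -> 'M[R]_d) (b : T -> 'cV[R]_d).

Definition Dop (f : T -> 'cV[R]_d) : T -> 'cV[R]_d := fun x => A x *m f x.

Definition Dbar (f : T -> 'cV[R]_d) : T -> 'cV[R]_d :=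
  fun x => invmx (mmean A pi) *m (A x *m f x).

(* (I - P^* + Pi)^{-1} (P^* - Pi) *)
Definition resolvent (f : T -> 'cV[R]_d) : T -> 'cV[R]_d :=
  bounded_inverse pi vL2 (L2norm pi (@enorm R d)) (fun g => g - vPadj g + vPi g)
    (vPadj f - vPi f).

Definition Xi (f : T -> 'cV[R]_d) : T -> 'cV[R]_d :=
  resolvent (Dop (f - vPi (Dbar f))).

Definition upsilon (theta : 'cV[R]_d) : T -> 'cV[R]_d :=
  resolvent (fun x => A x *m theta + b x).

(* Meaningful for i >= 1. *)
Definition Bcoef (theta : 'cV[R]_d) (i : nat) : 'cV[R]_d :=
  - vmean pi (Dbar (iter i.-1 Xi (upsilon theta))).

End bias_coefficients.

(* Main.v *)
Require Import Defs.
From HB Require Import structures.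
From mathcomp Require Import all_boot all_order all_algebra.
From mathcomp Require Import complex ring lra.
From mathcomp Require Import all_classical all_reals all_analysis.
From mathcomp Require Import measurable_realfun.

(* Put Q = P - Pi on L^2(pi).  Uniform ergodicity makes some power of P halve the
   sup norm of mean-zero bounded functions; since P is self-adjoint, the norms
   ||P^k f|| are log-convex in k, so P is a strict contraction on mean-zero
   functions in L^2.  Hence every z <> 1 with |z| > ||Q|| is in the resolvent set.
   Conversely, a self-adjoint operator cannot have both M - Q and M + Q bounded
   below when M = ||Q|| > 0, so the spectrum of P away from 1 reaches modulus
   ||Q||, that is ||Q|| = 1 - gamma with gamma the spectral gap, and gamma > 0.
   Therefore (I - P + Pi)^{-1} (P - Pi) has norm at most (1 - gamma) / gamma.
   B^(i) contains i such factors; the others are bounded by constants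
   depending only on A, b and pi. *)

Set Implicit Arguments.
Unset Strict Implicit.
Unset Printing Implicit Defensive.

Import Order.TTheory GRing.Theory Num.Theory.
Import numFieldNormedType.Exports.

Local Open Scope classical_set_scope.
Local Open Scope ring_scope.

(** * Semi-inner product spaces *)

(** Functions are handled as representatives, so norms are seminorms, and linearity, inverses,
    adjoints and fixed points are available only up to vectors of seminorm 0. Uniform ergodicity
    speaks of sup norms, the spectral gap of L^2 norms, and no constant bounds the former by the
    latter. Log-convexity gets around this: the decay of [P^k f] may carry a constant depending on
    [f], because comparing exponential growth rates as k grows eliminates it. This works for bounded
    [f] only; a duality argument with truncations then reaches all of L^2 with the same factor. The
    spectrum is complex while the coefficients are real vectors. Pairs of real functions model the
    complexification, and vector functions are treated coordinate by coordinate, so that a single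
    real scalar operator carries the whole analysis. *)

Lemma le0_geometric (R : realType) (x C q : R) : 0 <= q < 1 ->
  (forall n, x <= C * q ^+ n) -> x <= 0.
Proof.
move=> /andP[q0 q1] xC.
have cq : C * q ^+ n @[n --> \oo] --> (C * 0 : R).
  by apply: cvgMr; apply: cvg_expr; rewrite ger0_norm.
rewrite mulr0 in cq.
rewrite -(cvg_lim (@Rhausdorff R) cq); apply: limr_ge.
  by apply/cvg_ex; exists 0.
by apply: nearW.
Qed.

Lemma geometric_unbounded (R : realType) (s r a C : R) : 0 < r -> r < s ->
  0 < a -> ~ (forall k, s ^+ k * a <= C * r ^+ k).
Proof.
move=> r0 rs a0 H.
have s0 : 0 < s by apply: lt_trans rs.
have : a <= 0.
  apply: (@le0_geometric _ _ C (r / s)).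
    by rewrite divr_ge0 ?ltW//= ltr_pdivrMr// mul1r.
  move=> n; rewrite expr_div_n mulrA ler_pdivlMr ?exprn_gt0// mulrC; exact: H.
by rewrite leNgt a0.
Qed.

(** The form is only semidefinite because functions are not identified modulo null sets. [L] is a
    subset because integrals are additive only on integrable functions; symmetry needs no such
    restriction. *)
Record semi_inner_product (R : realType) (V : lmodType R) (L : set V)
    (ip : V -> V -> R) : Prop := SemiInnerProduct {
  sip0 : L 0;
  sipPl : forall a f g, L f -> L g -> L (a *: f + g);
  sipC : forall f g, ip f g = ip g f;
  sip_linear : forall a f g h, L f -> L g -> L h ->
    ip (a *: f + g) h = a * ip f h + ip g h;
  sip_ge0 : forall f, L f -> 0 <= ip f f }.

Definition seminorm_of (R : realType) (V : lmodType R) (ip : V -> V -> R) (f : V) : R :=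
  Num.sqrt (ip f f).

(** Neither linearity nor boundedness is demanded: symmetry already yields linearity up to seminorm
    0, and bounds are stated separately. *)
Definition selfadjoint (R : realType) (V : lmodType R) (L : set V)
    (ip : V -> V -> R) (Q : V -> V) : Prop :=
  (forall f, L f -> L (Q f)) /\
  forall f g, L f -> L g -> ip (Q f) g = ip f (Q g).

(** Completeness for geometrically fast sequences only, as produced by Banach iteration; the limit
    is approached at the same rate [q]. *)
Definition geometrically_complete (R : realType) (V : lmodType R) (L : set V)
    (ip : V -> V -> R) : Prop :=
  forall (u : nat -> V) (C q : R), 0 <= q < 1 -> (forall n, L (u n)) ->
    (forall n, seminorm_of ip (u n.+1 - u n) <= C * q ^+ n) ->
    exists2 v, L v & exists C', forall n, seminorm_of ip (u n - v) <= C' * q ^+ n.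

Section semi_inner_product_theory.
Context {R : realType} {V : lmodType R} {L : set V} {ip : V -> V -> R}.
Hypothesis H : semi_inner_product L ip.
Local Notation nrm := (seminorm_of ip).
Implicit Types f g h : V.

Lemma sipD f g : L f -> L g -> L (f + g).
Proof. by move=> Lf Lg; rewrite -[f]scale1r; apply: (sipPl H). Qed.

Lemma sipZ a f : L f -> L (a *: f).
Proof. by move=> Lf; rewrite -[_ *: _]addr0; apply: (sipPl H) => //; apply: (sip0 H). Qed.

Lemma sipN f : L f -> L (- f).
Proof. by move=> Lf; rewrite -scaleN1r; apply: sipZ. Qed.

Lemma sipB f g : L f -> L g -> L (f - g).
Proof. by move=> Lf Lg; apply: sipD => //; apply: sipN. Qed.

Lemma ipDl f g h : L f -> L g -> L h -> ip (f + g) h = ip f h + ip g h.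
Proof.
by move=> Lf Lg Lh; rewrite -[f]scale1r (sip_linear H)// mul1r scale1r.
Qed.

Lemma ip0l h : L h -> ip 0 h = 0.
Proof.
move=> Lh; have L0 := sip0 H.
by have := ipDl L0 L0 Lh; rewrite addr0 => /eqP; rewrite -subr_eq0 opprD addNKr oppr_eq0 => /eqP.
Qed.

Lemma ipZl a f h : L f -> L h -> ip (a *: f) h = a * ip f h.
Proof.
move=> Lf Lh; rewrite -[_ *: _]addr0 (sip_linear H)//; last exact: (sip0 H).
by rewrite ip0l// addr0.
Qed.

Lemma ipBl f g h : L f -> L g -> L h -> ip (f - g) h = ip f h - ip g h.
Proof.
by move=> Lf Lg Lh; rewrite -(scaleN1r g) ipDl ?ipZl ?mulN1r//; exact: sipZ.
Qed.

Lemma ipDr f g h : L f -> L g -> L h -> ip h (f + g) = ip h f + ip h g.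
Proof. by move=> *; rewrite !(sipC H h) ipDl. Qed.

Lemma ipBr f g h : L f -> L g -> L h -> ip h (f - g) = ip h f - ip h g.
Proof. by move=> *; rewrite !(sipC H h) ipBl. Qed.

Lemma ipZr a f h : L f -> L h -> ip h (a *: f) = a * ip h f.
Proof. by move=> *; rewrite !(sipC H h) ipZl. Qed.

Lemma seminorm_ge0 f : 0 <= nrm f.
Proof. exact: sqrtr_ge0. Qed.

Lemma sqr_seminorm f : L f -> nrm f ^+ 2 = ip f f.
Proof. by move=> Lf; rewrite sqr_sqrtr//; exact: (sip_ge0 H). Qed.

Lemma le_seminorm f x : L f -> 0 <= x -> ip f f <= x ^+ 2 -> nrm f <= x.
Proof.
move=> Lf x0 fx; rewrite -(@ler_pXn2r _ 2) ?nnegrE ?seminorm_ge0//.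
by rewrite sqr_seminorm.
Qed.

Lemma cauchy_schwarz f g : L f -> L g -> `|ip f g| <= nrm f * nrm g.
Proof.
move=> Lf Lg.
rewrite -(@ler_pXn2r _ 2) ?nnegrE ?mulr_ge0 ?seminorm_ge0//.
rewrite real_normK ?num_real// exprMn !sqr_seminorm//.
have ff := sip_ge0 H Lf; have gg := sip_ge0 H Lg.
have pos t : 0 <= ip f f - 2 * t * ip f g + t ^+ 2 * ip g g.
  have Lt := sipZ t Lg; have Lh := sipB Lf Lt; have := sip_ge0 H Lh.
  rewrite (ipBl Lf Lt Lh) (ipBr Lf Lt Lf) (ipBr Lf Lt Lt) (ipZl t Lg Lf).
  rewrite (ipZr t Lg Lf) (ipZl t Lg Lt) (ipZr t Lg Lg) (sipC H g f).
  by congr (_ <= _); ring.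
(* A nonzero [g] may have seminorm 0. Then [pos] is affine in [t], and if [ip f g] were nonzero the
   chosen [t] would give the value -1. *)
have [g0|gn0] := eqVneq (ip g g) 0.
  suff -> : ip f g = 0 by rewrite expr0n mulr_ge0.
  apply/eqP/negPn/negP => fg0.
  have := pos ((ip f f + 1) / (2 * ip f g)).
  rewrite g0 mulr0 addr0.
  have -> : 2 * ((ip f f + 1) / (2 * ip f g)) * ip f g = ip f f + 1 by field.
  lra.
have g0 : 0 < ip g g by rewrite lt_def gn0.
have := pos (ip f g / ip g g).
have -> : ip f f - 2 * (ip f g / ip g g) * ip f g + (ip f g / ip g g) ^+ 2 * ip g g =
  (ip f f * ip g g - ip f g ^+ 2) / ip g g by field.
by rewrite pmulr_lge0 ?invr_gt0// subr_ge0.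
Qed.

Lemma seminormD f g : L f -> L g -> nrm (f + g) <= nrm f + nrm g.
Proof.
move=> Lf Lg; apply: le_seminorm; first exact: sipD.
  by rewrite addr_ge0 ?seminorm_ge0.
rewrite ipDl ?ipDr ?sqrrD ?sqr_seminorm ?(sipC H g f)//; try exact: sipD.
have := le_trans (ler_norm _) (cauchy_schwarz Lf Lg).
set a := ip f g; set b := nrm f * nrm g => ab.
have -> : b *+ 2 = b + b by rewrite mulr2n.
lra.
Qed.

Lemma seminormZ a f : L f -> nrm (a *: f) = `|a| * nrm f.
Proof.
move=> Lf; rewrite /seminorm_of (ipZl a Lf (sipZ a Lf)) (ipZr a Lf Lf) mulrA.
by rewrite -expr2 sqrtrM ?sqr_ge0// sqrtr_sqr.
Qed.

Lemma seminorm_sub f g : L f -> L g -> nrm (f - g) = nrm (g - f).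
Proof.
move=> Lf Lg; rewrite -opprB -(scaleN1r (g - f)) seminormZ ?normrN1 ?mul1r//.
exact: sipB.
Qed.

Lemma seminorm_triangle f g h : L f -> L g -> L h ->
  nrm (f - h) <= nrm (f - g) + nrm (g - h).
Proof.
move=> Lf Lg Lh; have -> : f - h = (f - g) + (g - h) by rewrite addrA subrK.
by apply: seminormD; apply: sipB.
Qed.

Lemma seminormB f g : L f -> L g -> nrm (f - g) <= nrm f + nrm g.
Proof.
move=> Lf Lg; apply: (le_trans (seminormD Lf (sipN Lg))).
by rewrite -(scaleN1r g) seminormZ// normrN1 mul1r.
Qed.

Lemma seminorm_eq f g : L f -> L g -> nrm (f - g) = 0 -> nrm f = nrm g.
Proof.
move=> Lf Lg fg; apply/eqP; rewrite eq_le.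
have L0 := sip0 H.
have := seminorm_triangle Lf Lg L0; have := seminorm_triangle Lg Lf L0.
by rewrite !subr0 (seminorm_sub Lg Lf) fg !add0r => -> ->.
Qed.

(** * Symmetric operators *)

Section selfadjoint.
Variable Q : V -> V.
Hypothesis HQ : selfadjoint L ip Q.

Let QL f : L f -> L (Q f). Proof. exact: HQ.1. Qed.

Lemma selfadjoint_iter n f : L f -> L (iter n Q f).
Proof. by move=> Lf; elim: n => //= n; apply: QL. Qed.

(** Moving [Q] to the other argument shows that the defect [h] is orthogonal to [L], hence to
    itself. *)
Lemma selfadjoint_linear a f g : L f -> L g ->
  nrm (Q (a *: f + g) - (a *: Q f + Q g)) = 0.
Proof.
move=> Lf Lg; set h := _ - _.
have L1 := sipPl H a Lf Lg; have L2 := sipPl H a (QL Lf) (QL Lg).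
have Lh : L h by apply: sipB => //; exact: QL.
rewrite /seminorm_of {1}/h ipBl//; last exact: QL.
rewrite HQ.2// !(sip_linear H)//; try exact: QL.
by rewrite -!HQ.2// subrr sqrtr0.
Qed.

(* The sequence [nrm (iter k Q f)] is log-convex. *)
Lemma selfadjoint_iterate_bound (m : nat) (r C : R) f : (0 < m)%N -> 0 < r -> L f ->
  (forall k, nrm (iter (m * k) Q f) <= C * r ^+ (m * k)) ->
  nrm (Q f) <= r * nrm f.
Proof.
move=> m0 r0 Lf HC; rewrite leNgt; apply/negP => lt.
have f0 : 0 < nrm f.
  rewrite lt_def seminorm_ge0 andbT; apply/eqP => f0.
  have : ip (Q f) (Q f) = 0.
    rewrite (HQ.2 _ _ Lf (QL Lf)); apply/eqP; rewrite -normr_le0.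
    apply: le_trans (cauchy_schwarz _ _) _ => //; first by do 2 apply: QL.
    by rewrite f0 mul0r.
  by rewrite f0 mulr0 /seminorm_of in lt => e; rewrite e sqrtr0 ltxx in lt.
(* By log-convexity the successive ratios are nondecreasing, so all are at least the first one, [s].
   If [s > r], then [s ^+ k * nrm f] outgrows [C * r ^+ k], already along multiples of [m]. *)
pose s := nrm (Q f) / nrm f.
have s0 : r < s by rewrite ltr_pdivlMr.
have step k : 0 < nrm (iter k Q f) /\
    s * nrm (iter k Q f) <= nrm (iter k.+1 Q f).
  elim: k => [|k [IH0 IH1]].
    by split => //=; rewrite divfK// gt_eqF.
  have k1 : 0 < nrm (iter k.+1 Q f).
    by apply: lt_le_trans IH1; rewrite mulr_gt0// (lt_trans r0).
  split => //.
  have Lk := selfadjoint_iter k Lf.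
  have h : nrm (iter k.+1 Q f) ^+ 2 <= nrm (iter k Q f) * nrm (iter k.+2 Q f).
    rewrite sqr_seminorm; last exact: selfadjoint_iter.
    rewrite /= (HQ.2 _ _ Lk (QL Lk)); apply: le_trans (ler_norm _) _.
    by apply: cauchy_schwarz => //; do 2 apply: QL.
  rewrite -(ler_pM2l IH0); apply: le_trans h.
  by rewrite expr2 mulrA ler_pM2r// mulrC.
have geo k : s ^+ k * nrm f <= nrm (iter k Q f).
  elim: k => [|k IH]; first by rewrite expr0 mul1r.
  rewrite exprS -mulrA; apply: le_trans (step k).2.
  by rewrite ler_pM2l// (lt_trans r0).
apply: (@geometric_unbounded R (s ^+ m) (r ^+ m) (nrm f) C) => //.
- by rewrite exprn_gt0.
- by rewrite ltr_pXn2r// ?nnegrE ?ltW// (lt_trans r0).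
- by move=> k; rewrite -!exprM; apply: le_trans (HC k).
Qed.

(* Since ‖(M²-Q²)f‖² <= M²(M²‖f‖²-‖Qf‖²), the bound [M] can be improved as soon
   as both [M - Q] and [M + Q] are bounded below. *)
Lemma selfadjoint_improve_bound (M K : R) : 0 < M -> 0 < K ->
  (forall f, L f -> nrm (Q f) <= M * nrm f) ->
  (forall f, L f -> nrm f <= K * nrm (M *: f - Q f)) ->
  (forall f, L f -> nrm f <= K * nrm ((- M) *: f - Q f)) ->
  exists M', [/\ 0 <= M', M' < M & forall f, L f -> nrm (Q f) <= M' * nrm f].
Proof.
move=> M0 K0 QM Kp Km.
(* This solves [‖f‖² <= K⁴ M² (M²‖f‖² - ‖Qf‖²)] for [‖Qf‖²], the factor [K⁴] coming from the two
   lower bounds applied in turn. *)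
pose c := M ^+ 2 - (K ^+ 4 * M ^+ 2)^-1.
have bnd f : L f -> nrm (Q f) ^+ 2 <= c * nrm f ^+ 2.
  move=> Lf; have LQ := QL Lf; have LQQ := QL LQ.
  have Lh : L (M *: f + Q f) by apply: (sipPl H).
  pose h := M *: f + Q f.
  have Lk : L (M ^+ 2 *: f - Q (Q f)) by apply: sipB => //; apply: sipZ.
  have e : nrm (M *: h - Q h) = nrm (M ^+ 2 *: f - Q (Q f)).
    apply: seminorm_eq => //.
      by apply: sipB; [apply: sipZ|apply: QL].
    have := selfadjoint_linear M Lf LQ; rewrite seminorm_sub//; last 2 first.
      exact: QL.
      exact: (sipPl H).
    rewrite -/h => <-; congr nrm.
    have shuffle (x y z w : V) : x + y - z - (x - w) = y + w - z.
      by rewrite opprB [LHS]addrC !addrA subrK [w + y]addrC.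
    by rewrite {1}/h scalerDr scalerA -expr2 shuffle.
  have n1 : nrm f <= K * nrm h.
    apply: (le_trans (Km _ Lf)).
    by rewrite scaleNr -opprD -(scaleN1r (M *: f + _)) seminormZ// normrN1 mul1r.
  have n2 : nrm f <= K ^+ 2 * nrm (M ^+ 2 *: f - Q (Q f)).
    apply: (le_trans n1); rewrite expr2 -mulrA ler_pM2l//.
    by rewrite -e; apply: Kp.
  have n3 : nrm f ^+ 2 <= K ^+ 4 * nrm (M ^+ 2 *: f - Q (Q f)) ^+ 2.
    rewrite (exprM K 2 2) -exprMn.
    by rewrite ler_pXn2r// nnegrE ?seminorm_ge0// mulr_ge0 ?seminorm_ge0 ?exprn_ge0 ?ltW.
  have n4 : nrm (M ^+ 2 *: f - Q (Q f)) ^+ 2 <=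
      M ^+ 2 * (M ^+ 2 * nrm f ^+ 2 - nrm (Q f) ^+ 2).
    have n5 : nrm (Q (Q f)) ^+ 2 <= M ^+ 2 * nrm (Q f) ^+ 2.
      rewrite -exprMn ler_pXn2r ?nnegrE ?mulr_ge0 ?seminorm_ge0//; last exact: ltW.
      exact: QM.
    have Lm := sipZ (M ^+ 2) Lf.
    rewrite (sqr_seminorm Lk) (ipBl Lm LQQ Lk) (ipBr Lm LQQ Lm) (ipBr Lm LQQ LQQ).
    rewrite (ipZl _ Lf Lm) (ipZr _ Lf Lf) (ipZr _ Lf LQQ) (ipZl _ Lf LQQ).
    have e1 : ip f (Q (Q f)) = nrm (Q f) ^+ 2 by rewrite sqr_seminorm// HQ.2.
    rewrite (sipC H (Q (Q f)) f) e1 -!sqr_seminorm//; lra.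
  have n6 := le_trans n3 (ler_wpM2l (exprn_ge0 4 (ltW K0)) n4).
  rewrite /c mulrBl lerBrDr -lerBrDl mulrC ler_pdivrMr ?mulr_gt0 ?exprn_gt0//.
  by apply: le_trans n6 _; rewrite mulrA mulrC.
(* [c] can be negative when every vector of [L] has seminorm 0, hence the maximum. *)
exists (Num.sqrt (Num.max c 0)); split; first exact: sqrtr_ge0.
- rewrite -[ltRHS](ger0_norm (ltW M0)) -sqrtr_sqr ltr_sqrt ?exprn_gt0//.
  rewrite gt_max exprn_gt0// andbT /c ltrBlDr ltrDl invr_gt0.
  by rewrite mulr_gt0 ?exprn_gt0.
- move=> f Lf; apply: le_seminorm; first exact: QL.
    by rewrite mulr_ge0 ?sqrtr_ge0 ?seminorm_ge0.
  rewrite -(sqr_seminorm (QL Lf)) exprMn.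
  rewrite (@sqr_sqrtr _ (Num.max c 0)); last by rewrite le_max lexx orbT.
  apply: le_trans (bnd _ Lf) _.
  by apply: ler_wpM2r; rewrite ?sqr_ge0// le_max lexx.
Qed.

End selfadjoint.

(** Banach iteration from 0. Since the seminorm does not separate points, the fixed-point equation
    is obtained only up to seminorm 0, from an error at most [2 * C' * q ^+ n] for every [n]. *)
Lemma contraction_fixpoint (G : V -> V) (q : R) : geometrically_complete L ip ->
  0 <= q < 1 -> (forall f, L f -> L (G f)) ->
  (forall f g, L f -> L g -> nrm (G f - G g) <= q * nrm (f - g)) ->
  exists2 u, L u & nrm (G u - u) = 0.
Proof.
move=> complL q01 GL Gq; have /andP[q0 q1] := q01.
pose u n := iter n G 0.
have Lu n : L (u n) by elim: n => [|n]; [exact: (sip0 H)|exact: GL].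
have [n|v Lv [C' HC']] := complL u (nrm (u 1%N - u 0%N)) q q01 Lu.
  elim: n => [|n IH]; first by rewrite expr0 mulr1.
  apply: le_trans (Gq _ _ (Lu n.+1) (Lu n)) _.
  by rewrite exprS mulrCA ler_wpM2l.
exists v => //; apply/eqP; rewrite eq_le seminorm_ge0 andbT.
apply: (@le0_geometric _ _ (2 * C') q q01) => n.
apply: le_trans (seminorm_triangle (GL _ Lv) (Lu n.+1) Lv) _.
have h1 := HC' n.+1.
have h2 : nrm (G v - u n.+1) <= q * nrm (u n - v).
  by rewrite (seminorm_sub (Lu n)) //; apply: Gq.
have h3 := HC' n.
have h4 : q * nrm (u n - v) <= q * (C' * q ^+ n) by rewrite ler_wpM2l.
have h5 : q * (C' * q ^+ n) <= C' * q ^+ n.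
  apply: ler_piMl (ltW q1); apply: le_trans h3; exact: seminorm_ge0.
have h6 : C' * q ^+ n.+1 = q * (C' * q ^+ n) by rewrite exprS mulrCA.
lra.
Qed.

End semi_inner_product_theory.

(** * Complexification by pairs of vectors *)

Section complexification.
Context {R : realType} {V : lmodType R} {L : set V} {ip : V -> V -> R}.
Hypothesis H : semi_inner_product L ip.
Local Notation nrm := (seminorm_of ip).
Implicit Types (p q : V * V) (f g : V) (a b : R).

Definition pairL : set (V * V) := [set p | L p.1 /\ L p.2].

(** The real part of the Hermitian product. It induces the same seminorm, so the real theory above
    applies to pairs. *)
Definition pair_ip p q : R := ip p.1 q.1 + ip p.2 q.2.

Local Notation nrm2 := (seminorm_of pair_ip).

(* A pair [(f, g)] stands for [f + i g], so that this is multiplication by [a + i b]. *)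
Definition cmul a b p : V * V := (a *: p.1 - b *: p.2, a *: p.2 + b *: p.1).

Lemma pair_sip : semi_inner_product pairL pair_ip.
Proof.
split.
- by split; exact: (sip0 H).
- by move=> a p q [? ?] [? ?]; split; apply: (sipPl H).
- by move=> p q; rewrite /pair_ip !(sipC H p.1) !(sipC H p.2).
- move=> a p q h [p1 p2] [q1 q2] [h1 h2].
  by rewrite /pair_ip /= !(sip_linear H)//; ring.
- by move=> p [? ?]; apply: addr_ge0; apply: (sip_ge0 H).
Qed.

Lemma sqr_pair_seminorm p : pairL p -> nrm2 p ^+ 2 = nrm p.1 ^+ 2 + nrm p.2 ^+ 2.
Proof. by move=> [? ?]; rewrite (sqr_seminorm pair_sip)// !(sqr_seminorm H). Qed.

Lemma pair_seminorm_fst p : pairL p -> nrm p.1 <= nrm2 p.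
Proof.
move=> Lp; have [L1 _] := Lp; apply: (le_seminorm H) => //.
  exact: seminorm_ge0.
by rewrite -(sqr_seminorm H)// sqr_pair_seminorm// lerDl sqr_ge0.
Qed.

Lemma pair_seminorm_snd p : pairL p -> nrm p.2 <= nrm2 p.
Proof.
move=> Lp; have [_ L2] := Lp; apply: (le_seminorm H) => //.
  exact: seminorm_ge0.
by rewrite -(sqr_seminorm H)// sqr_pair_seminorm// lerDr sqr_ge0.
Qed.

Lemma pair_seminorm_le p : pairL p -> nrm2 p <= nrm p.1 + nrm p.2.
Proof.
move=> Lp; apply: (le_seminorm pair_sip) => //.
  by rewrite addr_ge0 ?seminorm_ge0.
rewrite -(sqr_seminorm pair_sip)// sqr_pair_seminorm// sqrrD lerD2r lerDl.
by rewrite mulrn_wge0// mulr_ge0 ?seminorm_ge0.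
Qed.

Lemma pair_complete : geometrically_complete L ip -> geometrically_complete pairL pair_ip.
Proof.
move=> cL u C q q01 Lu uq.
have LB n : pairL (u n.+1 - u n) by apply: (sipB pair_sip).
have [v1 Lv1 [C1 h1]] := cL (fun n => (u n).1) C q q01 (fun n => (Lu n).1)
  (fun n => le_trans (pair_seminorm_fst (LB n)) (uq n)).
have [v2 Lv2 [C2 h2]] := cL (fun n => (u n).2) C q q01 (fun n => (Lu n).2)
  (fun n => le_trans (pair_seminorm_snd (LB n)) (uq n)).
exists (v1, v2) => //; exists (C1 + C2) => n.
have Lv : pairL (u n - (v1, v2)) by apply: (sipB pair_sip).
rewrite mulrDl; apply: le_trans (pair_seminorm_le Lv) _.
by apply: lerD; [exact: h1|exact: h2].
Qed.

Lemma cmul_pairL a b p : pairL p -> pairL (cmul a b p).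
Proof.
by move=> [? ?]; split; [apply: (sipB H)|apply: (sipD H)]; apply: (sipZ H).
Qed.

Lemma pair_seminorm_cmul a b p : pairL p ->
  nrm2 (cmul a b p) = Num.sqrt (a ^+ 2 + b ^+ 2) * nrm2 p.
Proof.
move=> Lp; have [L1 L2] := Lp.
rewrite -sqrtrM ?addr_ge0 ?sqr_ge0//; congr Num.sqrt.
have ha f := sipZ H a (f := f); have hb f := sipZ H b (f := f).
rewrite /pair_ip /= (ipBl H (ha _ L1) (hb _ L2)); last by apply: (sipB H); auto.
rewrite (ipDl H (ha _ L2) (hb _ L1)); last by apply: (sipD H); auto.
rewrite (ipBr H (ha _ L1) (hb _ L2) (ha _ L1)) (ipBr H (ha _ L1) (hb _ L2) (hb _ L2)).
rewrite (ipDr H (ha _ L2) (hb _ L1) (ha _ L2)) (ipDr H (ha _ L2) (hb _ L1) (hb _ L1)).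
rewrite !(ipZl H _ L1 (ha _ _)) ?(ipZl H _ L1 (hb _ _))//; try by auto.
rewrite !(ipZl H _ L2 (ha _ _)) ?(ipZl H _ L2 (hb _ _))//; try by auto.
rewrite !(ipZr H _ L1) ?(ipZr H _ L2)// (sipC H p.2 p.1); ring.
Qed.

Lemma cmulB a b p q : cmul a b (p - q) = cmul a b p - cmul a b q.
Proof.
case: p q => [p1 p2] [q1 q2]; congr pair; rewrite /= !scalerBr.
  by rewrite !opprB addrACA [RHS]addrACA; congr (_ + _); rewrite addrC.
by rewrite opprD addrACA.
Qed.

Lemma cmulD a b p q : cmul a b (p + q) = cmul a b p + cmul a b q.
Proof.
case: p q => [p1 p2] [q1 q2]; congr pair; rewrite /= !scalerDr ?opprD addrACA//.
Qed.

Lemma cmulCA a b c d p : cmul a b (cmul c d p) = cmul c d (cmul a b p).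
Proof.
case: p => p1 p2; congr pair; rewrite /= !scalerBr !scalerDr !scalerA.
  by rewrite !opprD addrACA [a * c]mulrC [b * d]mulrC [a * d]mulrC [b * c]mulrC.
by rewrite addrACA [a * c]mulrC [b * d]mulrC [a * d]mulrC [b * c]mulrC.
Qed.

(** The hypotheses are the real and imaginary parts of (a + ib)(c + ie) = 1. *)
Lemma cmulK a b c e p : a * c - b * e = 1 -> a * e + b * c = 0 ->
  cmul a b (cmul c e p) = p.
Proof.
move=> h1 h2; case: p => p1 p2; congr pair; rewrite /= scalerBr scalerDr !scalerA.
  rewrite [X in _ - X]addrC opprD addrACA -scalerBl h1 scale1r.
  by rewrite -opprD -scalerDl h2 scale0r subr0.
rewrite [X in _ + X]addrC addrACA -scalerBl h1 scale1r.
by rewrite -scalerDl h2 scale0r addr0.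
Qed.

(** * The resolvent of an operator with a known eigenvector *)

Section resolvent.
Variables (Q : V -> V) (e : V) (r : R).
Hypotheses (HQ : selfadjoint L ip Q) (Le : L e) (Qe : Q e = e) (e1 : ip e e = 1).

(** For [sP P] and the constant 1 this is P - Pi: the eigenvector of eigenvalue 1 is removed so that
    the remainder can have a small norm on the whole space. *)
Definition deflate f : V := Q f - ip f e *: e.

Hypotheses (r0 : 0 <= r) (Qr : forall f, L f -> nrm (deflate f) <= r * nrm f).

Let QL f : L f -> L (Q f). Proof. exact: HQ.1. Qed.

Let norm_e : nrm e = 1. Proof. by rewrite /seminorm_of e1 sqrtr1. Qed.

Lemma deflate_L f : L f -> L (deflate f).
Proof. by move=> Lf; apply: (sipB H); [exact: QL|exact: (sipZ H)]. Qed.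

Lemma deflate_selfadjoint : selfadjoint L ip deflate.
Proof.
split=> [|f g Lf Lg]; first exact: deflate_L.
have Lfe := sipZ H (ip f e) Le; have Lge := sipZ H (ip g e) Le.
rewrite /deflate (ipBl H (QL Lf) Lfe Lg) (ipBr H (QL Lg) Lge Lf) (HQ.2 _ _ Lf Lg).
by rewrite (ipZl H _ Le Lg) (ipZr H _ Le Lf) (sipC H e g) [ip g e * _]mulrC.
Qed.

Let dist f g : L f -> L g -> nrm (deflate f - deflate g) <= r * nrm (f - g).
Proof.
move=> Lf Lg; have Lfg := sipB H Lf Lg.
have Ldf := deflate_L Lf; have Ldg := deflate_L Lg; have Ldfg := deflate_L Lfg.
have := selfadjoint_linear H deflate_selfadjoint (-1) Lg Lf.
rewrite !scaleN1r ![- _ + _]addrC => e0.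
rewrite -(seminorm_eq H Ldfg (sipB H Ldf Ldg) e0); exact: Qr.
Qed.

Definition cap (F : V -> V) p : V * V := (F p.1, F p.2).

Variables (a b : R).
Hypotheses (r_lt : r < Num.sqrt (a ^+ 2 + b ^+ 2)) (ab1 : (a, b) <> (1, 0)).

Let z0 : 0 < a ^+ 2 + b ^+ 2.
Proof. by rewrite -sqrtr_gt0 (le_lt_trans r0). Qed.

Let z10 : 0 < (a - 1) ^+ 2 + b ^+ 2.
Proof.
rewrite lt_def addr_ge0 ?sqr_ge0// andbT paddr_eq0 ?sqr_ge0// !sqrf_eq0 subr_eq0.
by apply/negP => /andP[/eqP az /eqP bz]; apply: ab1; rewrite az bz.
Qed.

Let pair_le p q : pairL p -> pairL q -> nrm p.1 <= r * nrm q.1 ->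
  nrm p.2 <= r * nrm q.2 -> nrm2 p <= r * nrm2 q.
Proof.
move=> Lp Lq h1 h2; apply: (le_seminorm pair_sip) => //.
  by rewrite mulr_ge0 ?seminorm_ge0.
rewrite -(sqr_seminorm pair_sip)// exprMn !sqr_pair_seminorm// mulrDr -!exprMn.
by apply: lerD; rewrite lerXn2r ?nnegrE ?mulr_ge0 ?seminorm_ge0.
Qed.

Let cap_L (F : V -> V) p : (forall f, L f -> L (F f)) -> pairL p -> pairL (cap F p).
Proof. by move=> FL [? ?]; split; exact: FL. Qed.

Let cap_dist p q : pairL p -> pairL q ->
  nrm2 (cap deflate p - cap deflate q) <= r * nrm2 (p - q).
Proof.
move=> Lp Lq; have [p1 p2] := Lp; have [q1 q2] := Lq.
apply: pair_le; try exact: dist; last exact: (sipB pair_sip).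
by apply: (sipB pair_sip); apply: cap_L => //; exact: deflate_L.
Qed.

Let along (k1 k2 : R) : V * V := (k1 *: e, k2 *: e).

Let along_L k1 k2 : pairL (along k1 k2).
Proof. by split; exact: (sipZ H). Qed.

Let w2 := (a - 1) ^+ 2 + b ^+ 2.

Let w2_neq0 : w2 != 0. Proof. by rewrite gt_eqF. Qed.

Let cap_deflateE p : cap deflate p = cap Q p - along (ip p.1 e) (ip p.2 e).
Proof. by case: p. Qed.

(* From a fixed point [u] of [u |-> (h + (Q - <., e> e) u) / z], the component
   along [e] is corrected by [<u, e> / (z - 1)]. *)
Lemma resolvent_surjective h : geometrically_complete L ip -> pairL h ->
  exists2 u, pairL u & nrm2 (cmul a b u - cap Q u - h) = 0.
Proof.
move=> cL Lh.
pose z2 := a ^+ 2 + b ^+ 2.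
have z20 : z2 != 0 by rewrite gt_eqF.
have sz0 : 0 < Num.sqrt z2 by rewrite sqrtr_gt0.
(* [c + i s] is the inverse of [z = a + i b]; dividing by [z] makes [G] a contraction of ratio
   [r / |z|]. *)
pose c := a / z2; pose s := - b / z2.
have cs : c ^+ 2 + s ^+ 2 = z2^-1 by rewrite /c /s /z2; field.
pose G u := cmul c s (h + cap deflate u).
have LD p : pairL p -> pairL (cap deflate p) by apply: cap_L; exact: deflate_L.
have [|||u Lu Gu] := contraction_fixpoint pair_sip (G := G)
    (q := r / Num.sqrt z2) (pair_complete cL).
- by rewrite divr_ge0 ?sqrtr_ge0//= ltr_pdivrMr// mul1r.
- by move=> p Lp; apply: cmul_pairL; apply: (sipD pair_sip) => //; exact: LD.
- move=> p q Lp Lq; rewrite /G -cmulB pair_seminorm_cmul; last first.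
    by apply: (sipB pair_sip); apply: (sipD pair_sip) => //; exact: LD.
  rewrite opprD addrACA subrr add0r cs sqrtrV; last exact: ltW.
  rewrite [leLHS]mulrC [leRHS]mulrAC ler_wpM2r ?invr_ge0 ?sqrtr_ge0//.
  exact: cap_dist.
have LG : pairL (G u) by apply: cmul_pairL; apply: (sipD pair_sip) => //; exact: LD.
have Y0 : nrm2 (cmul a b u - (h + (cap Q u - along (ip u.1 e) (ip u.2 e)))) = 0.
  rewrite -cap_deflateE (seminorm_sub pair_sip); last first.
  - by apply: (sipD pair_sip) => //; exact: LD.
  - exact: cmul_pairL.
  have <- : cmul a b (G u) = h + cap deflate u.
    by apply: cmulK; rewrite /c /s /z2; field.
  rewrite -cmulB pair_seminorm_cmul ?Gu ?mulr0//.
  exact: (sipB pair_sip).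
set m1 := ip u.1 e in Y0; set m2 := ip u.2 e in Y0.
(* [k1 + i k2] is [(m1 + i m2) / (z - 1)]. Since [Q e = e], applying [z - Q] to this multiple of [e]
   multiplies it by [z - 1] and restores the projection removed by [deflate]. *)
pose k1 := ((a - 1) * m1 + b * m2) / w2.
pose k2 := ((a - 1) * m2 - b * m1) / w2.
have [Lu1 Lu2] := Lu.
exists (along k1 k2 + u); first exact: (sipD pair_sip).
have zk : cmul a b (along k1 k2) = along k1 k2 + along m1 m2.
  congr pair; rewrite /= !scalerA -?scalerBl -!scalerDl; congr (_ *: _).
    by rewrite /k1 /k2 /w2; field; exact: w2_neq0.
  by rewrite /k1 /k2 /w2; field; exact: w2_neq0.
have LQ p : pairL p -> pairL (cap Q p) by apply: cap_L.
have Z0 : nrm2 (along k1 k2 + cap Q u - cap Q (along k1 k2 + u)) = 0.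
  have LZ : pairL (along k1 k2 + cap Q u - cap Q (along k1 k2 + u)).
    apply: (sipB pair_sip); first by apply: (sipD pair_sip) => //; exact: LQ.
    by apply: LQ; apply: (sipD pair_sip).
  apply/eqP; rewrite eq_le seminorm_ge0 andbT.
  apply: le_trans (pair_seminorm_le LZ) _; rewrite /=.
  have n0 k f : L f -> nrm (k *: e + Q f - Q (k *: e + f)) = 0.
    move=> Lf; have Lkf := QL (sipPl H k Le Lf).
    have Lkq := sipPl H k Le (QL Lf).
    by rewrite (seminorm_sub H Lkq Lkf) -{2}Qe (selfadjoint_linear H HQ).
  by rewrite !n0// addr0.
have shuffle (W : zmodType) (x k m q q' h' : W) :
    k + m + x - q' - h' = (x - (h' + (q - m))) + (k + q - q').
  rewrite opprD opprB !addrA (addrAC _ (- q) k) subrK (addrAC _ (- q') (- h')).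
  by congr (_ - q'); rewrite -[LHS]addrA [LHS]addrC (addrC k) addrA.
have -> : cmul a b (along k1 k2 + u) - cap Q (along k1 k2 + u) - h =
    (cmul a b u - (h + (cap Q u - along m1 m2))) +
    (along k1 k2 + cap Q u - cap Q (along k1 k2 + u)).
  by rewrite -shuffle -zk cmulD.
apply/eqP; rewrite eq_le seminorm_ge0 andbT.
apply: le_trans (seminormD pair_sip _ _) _; last by rewrite Y0 Z0 addr0.
- apply: (sipB pair_sip); first exact: cmul_pairL.
  by apply: (sipD pair_sip) => //; apply: (sipB pair_sip) => //; exact: LQ.
- apply: (sipB pair_sip); first by apply: (sipD pair_sip) => //; exact: LQ.
  by apply: LQ; apply: (sipD pair_sip).
Qed.

(** Put [g = (z - Q) u]. Pairing with [e] gives [<g, e> = (z - 1) <u, e>], which controls the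
    component along [e] through [kappa]. Replacing [Q] by its deflation adds that component to [g],
    and [z - deflate] is bounded below by [|z| - r]. *)
Lemma resolvent_bounded : exists2 K, 0 < K & forall u, pairL u ->
  nrm2 u <= K * nrm2 (cmul a b u - cap Q u).
Proof.
pose kappa := (`|a - 1| + `|b|) / w2.
have kappa0 : 0 <= kappa by apply: divr_ge0; [exact: addr_ge0|exact: ltW z10].
have gap0 : 0 < Num.sqrt (a ^+ 2 + b ^+ 2) - r by rewrite subr_gt0.
exists ((1 + 2 * kappa) / (Num.sqrt (a ^+ 2 + b ^+ 2) - r)).
  by apply: divr_gt0 => //; lra.
move=> u Lu; have [Lu1 Lu2] := Lu.
have LQu : pairL (cap Q u) by apply: cap_L.
have Lzu := cmul_pairL a b Lu.
set g := cmul a b u - cap Q u; have Lg : pairL g by apply: (sipB pair_sip).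
have [Lg1 Lg2] := Lg; set N := nrm2 g.
set m1 := ip u.1 e; set m2 := ip u.2 e.
have Qm f : L f -> ip (Q f) e = ip f e by move=> Lf; rewrite HQ.2// Qe.
have n1 : ip g.1 e = (a - 1) * m1 - b * m2.
  rewrite /g /= (ipBl H (sipB H (sipZ H _ Lu1) (sipZ H _ Lu2)) (QL Lu1) Le).
  rewrite (ipBl H (sipZ H _ Lu1) (sipZ H _ Lu2) Le) !(ipZl H)// Qm// /m1 /m2; ring.
have n2 : ip g.2 e = (a - 1) * m2 + b * m1.
  rewrite /g /= (ipBl H (sipD H (sipZ H _ Lu2) (sipZ H _ Lu1)) (QL Lu2) Le).
  rewrite (ipDl H (sipZ H _ Lu2) (sipZ H _ Lu1) Le) !(ipZl H)// Qm// /m1 /m2; ring.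
have b1 : `|ip g.1 e| <= N.
  apply: le_trans (cauchy_schwarz H Lg1 Le) _.
  by rewrite norm_e mulr1; exact: pair_seminorm_fst.
have b2 : `|ip g.2 e| <= N.
  apply: le_trans (cauchy_schwarz H Lg2 Le) _.
  by rewrite norm_e mulr1; exact: pair_seminorm_snd.
have kN x y : `|x| <= N -> `|y| <= N -> `|((a - 1) * x + b * y) / w2| <= kappa * N.
  move=> xN yN; rewrite normrM normfV (ger0_norm (ltW z10)) /kappa mulrAC.
  rewrite ler_wpM2r//; first by rewrite invr_ge0; exact: ltW z10.
  apply: le_trans (ler_normD _ _) _; rewrite !normrM mulrDl.
  by apply: lerD; rewrite ler_wpM2l.
have M1 : `|m1| <= kappa * N.
  have -> : m1 = ((a - 1) * ip g.1 e + b * ip g.2 e) / w2.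
    by rewrite n1 n2 /w2; field; exact: w2_neq0.
  exact: kN.
have M2 : `|m2| <= kappa * N.
  have -> : m2 = ((a - 1) * ip g.2 e + b * (- ip g.1 e)) / w2.
    by rewrite n1 n2 /w2; field; exact: w2_neq0.
  by apply: kN; rewrite ?normrN.
have e2 : cmul a b u - cap deflate u = g + along m1 m2.
  by rewrite cap_deflateE opprB addrA addrAC.
have d2 : nrm2 (cap deflate u) <= r * nrm2 u.
  by apply: pair_le => //; try exact: Qr; apply: cap_L => //; exact: deflate_L.
have Ld : pairL (cap deflate u) by apply: cap_L => //; exact: deflate_L.
have al : nrm2 (along m1 m2) <= `|m1| + `|m2|.
  apply: le_trans (pair_seminorm_le (along_L _ _)) _.
  by rewrite /= !(seminormZ H)// norm_e !mulr1.
have t1 : Num.sqrt (a ^+ 2 + b ^+ 2) * nrm2 u <= nrm2 (g + along m1 m2) + nrm2 (cap deflate u).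
  rewrite -pair_seminorm_cmul// -e2.
  rewrite -{1}(subrK (cap deflate u) (cmul a b u)).
  by apply: (seminormD pair_sip) => //; apply: (sipB pair_sip).
have t2 : nrm2 (g + along m1 m2) <= N + nrm2 (along m1 m2) by apply: (seminormD pair_sip).
rewrite mulrAC ler_pdivlMr//; lra.
Qed.

Let Bop p := cmul a b p - cap Q p.

Let Bop_L p : pairL p -> pairL (Bop p).
Proof. by move=> Lp; apply: (sipB pair_sip); [exact: cmul_pairL|exact: cap_L]. Qed.

Let lincomb_L c d p q : pairL p -> pairL q -> pairL (cmul c d p + q).
Proof. by move=> Lp Lq; apply: (sipD pair_sip) => //; exact: cmul_pairL. Qed.

Let cap_linear c d p q : pairL p -> pairL q ->
  nrm2 (cap Q (cmul c d p + q) - (cmul c d (cap Q p) + cap Q q)) = 0.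
Proof.
move=> Lp Lq; have [p1 p2] := Lp; have [q1 q2] := Lq.
have lin x y f g h : L f -> L g -> L h ->
    nrm (Q (x *: f + y *: g + h) - (x *: Q f + y *: Q g + Q h)) = 0.
  move=> Lf Lg Lh; rewrite -!addrA.
  have Lgh := sipPl H y Lg Lh.
  apply/eqP; rewrite eq_le seminorm_ge0 andbT.
  have L1 : L (Q (x *: f + (y *: g + h))) by apply: QL; exact: (sipPl H).
  have L2 : L (x *: Q f + Q (y *: g + h)) by apply: (sipPl H); apply: QL.
  have L3 : L (y *: Q g + Q h) by apply: (sipPl H); apply: QL.
  have L4 : L (x *: Q f + (y *: Q g + Q h)) by apply: (sipPl H) => //; apply: QL.
  apply: le_trans (seminorm_triangle H L1 L2 L4) _.
  rewrite (selfadjoint_linear H HQ)// opprD addrACA subrr !add0r.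
  by rewrite (selfadjoint_linear H HQ).
set r2 := _ - _.
have Lr : pairL r2.
  apply: (sipB pair_sip); first by apply: cap_L => //; exact: lincomb_L.
  by apply: lincomb_L; exact: cap_L.
apply/eqP; rewrite eq_le seminorm_ge0 andbT.
apply: le_trans (pair_seminorm_le Lr) _; rewrite /r2 /= -!scaleNr.
by rewrite !lin// addr0.
Qed.

Let Bop_linear c d p q : pairL p -> pairL q ->
  nrm2 (Bop (cmul c d p + q) - (cmul c d (Bop p) + Bop q)) = 0.
Proof.
move=> Lp Lq.
have L1 : pairL (cmul c d (cap Q p) + cap Q q) by apply: lincomb_L; exact: cap_L.
have L2 : pairL (cap Q (cmul c d p + q)) by apply: cap_L => //; exact: lincomb_L.
rewrite -[RHS](cap_linear c d Lp Lq) (seminorm_sub pair_sip L2 L1).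
congr nrm2.
have -> : cmul c d (Bop p) + Bop q =
    cmul a b (cmul c d p + q) - (cmul c d (cap Q p) + cap Q q).
  by rewrite /Bop cmulB cmulD cmulCA opprD addrACA.
by rewrite opprB addrC addrA subrK.
Qed.

(** The preimages are chosen one vector at a time. That the choice is a left inverse and linear up
    to seminorm 0 follows from the lower bound, which makes [z - Q] injective modulo seminorm 0. *)
Lemma resolvent_exists : geometrically_complete L ip ->
  exists S K, forall p, pairL p ->
    [/\ pairL (S p), nrm2 (S p) <= K * nrm2 p,
        nrm2 (S (cmul a b p - cap Q p) - p) = 0,
        nrm2 (cmul a b (S p) - cap Q (S p) - p) = 0 &
        forall c d q, pairL q ->
          nrm2 (S (cmul c d p + q) - (cmul c d (S p) + S q)) = 0].
Proof.
move=> cL; have [K K0 HK] := resolvent_bounded.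
have /choice[S HS] : forall p, exists u, pairL p -> pairL u /\ nrm2 (Bop u - p) = 0.
  move=> p; have [Lp|nLp] := pselect (pairL p); last by exists 0.
  by have [u Lu Hu] := resolvent_surjective cL Lp; exists u.
have SL p : pairL p -> pairL (S p) by move=> /HS[].
have BS p : pairL p -> nrm2 (Bop (S p) - p) = 0 by move=> /HS[].
have BSn p : pairL p -> nrm2 (Bop (S p)) = nrm2 p.
  by move=> Lp; apply: (seminorm_eq pair_sip) => //; [apply: Bop_L; exact: SL|exact: BS].
have cm1 p : cmul (-1) 0 p = - p.
  by case: p => p1 p2; congr pair; rewrite /= !scaleN1r !scale0r ?subr0 ?addr0.
have inj p q : pairL p -> pairL q -> nrm2 (Bop p - Bop q) = 0 -> nrm2 (p - q) = 0.
  move=> Lp Lq e0; apply/eqP; rewrite eq_le seminorm_ge0 andbT.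
  apply: le_trans (HK _ (sipB pair_sip Lp Lq)) _.
  have := Bop_linear (-1) 0 Lq Lp; rewrite !cm1 ![- _ + _]addrC => e2.
  have LBB := sipB pair_sip (Bop_L Lp) (Bop_L Lq).
  rewrite -/(Bop _) (seminorm_eq pair_sip _ LBB e2) ?e0 ?mulr0//.
  by apply: Bop_L; exact: (sipB pair_sip).
exists S, K => p Lp; split.
- exact: SL.
- by rewrite -(BSn p Lp); apply: HK; exact: SL.
- by apply: inj => //; [apply: SL; exact: Bop_L|apply: BS; exact: Bop_L].
- exact: BS.
- move=> c d q Lq; have Lpq := lincomb_L c d Lp Lq.
  have LSp := SL _ Lp; have LSq := SL _ Lq.
  have L1 := Bop_L (SL _ Lpq).
  have L2 := lincomb_L c d (Bop_L LSp) (Bop_L LSq).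
  have L3 := Bop_L (lincomb_L c d LSp LSq).
  apply: inj; [exact: SL|exact: lincomb_L|].
  apply/eqP; rewrite eq_le seminorm_ge0 andbT.
  apply: le_trans (seminorm_triangle pair_sip L1 L2 L3) _.
  rewrite [X in _ + X](seminorm_sub pair_sip L2 L3) Bop_linear// addr0.
  apply: le_trans (seminorm_triangle pair_sip L1 Lpq L2) _.
  rewrite BS// add0r (seminorm_sub pair_sip Lpq L2) opprD addrACA -cmulB.
  have L4 := sipB pair_sip (Bop_L LSp) Lp.
  apply: le_trans (seminormD pair_sip (cmul_pairL c d L4) (sipB pair_sip (Bop_L LSq) Lq)) _.
  by rewrite pair_seminorm_cmul// !BS// mulr0 addr0.
Qed.

End resolvent.

End complexification.

Arguments pairL {R V} L.
Arguments pair_ip {R V} ip.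
Arguments deflate {R V} ip.

(** * Real square-integrable functions *)

Section scalar_L2.
Context {R : realType} {dT : measure_display} {T : measurableType dT}.
Variable pi : probability T R.
Implicit Types f g : T -> R.

(** Integrability of the square, rather than a finite norm, gives direct access to domination and to
    linearity of the integral; [finite_norm2P] links the two. *)
Definition sL2 : set (T -> R) :=
  [set f : T -> R | measurable_fun setT f /\ pi.-integrable setT (fun x => (f x ^+ 2)%:E)].

Definition sdot f g : R := \int[pi]_x (f x * g x).

Lemma sL2_measurable f : sL2 f -> measurable_fun setT f.
Proof. by case. Qed.

Lemma sL2_integrableM f g : sL2 f -> sL2 g ->
  pi.-integrable setT (fun x => (f x * g x)%:E).
Proof.
move=> [mf f2] [mg g2].
apply: le_integrable (integrableD measurableT f2 g2) => //.
  by apply/measurable_EFinP; apply: measurable_funM.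
move=> x _ /=; rewrite lee_fin.
rewrite [leRHS]ger0_norm ?addr_ge0 ?sqr_ge0// ler_norml.
by apply/andP; split; nra.
Qed.

Lemma bounded_sL2 f (B : R) : measurable_fun setT f -> (forall x, `|f x| <= B) ->
  sL2 f.
Proof.
move=> mf fB; split => //.
apply: (@le_integrable _ _ _ pi _ measurableT _ (cst (B ^+ 2)%:E)).
- by apply/measurable_EFinP; apply: measurable_funX.
- move=> x _ /=; rewrite lee_fin !normrX lerXn2r ?nnegrE//.
  exact: le_trans (fB x) (ler_norm _).
- by apply: finite_measure_integrable_cst.
Qed.

Lemma sL2_cst c : sL2 (cst c).
Proof. exact: (@bounded_sL2 _ `|c|). Qed.

Lemma sL2_integrable f : sL2 f -> pi.-integrable setT (fun x => (f x)%:E).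
Proof.
move=> Lf; have := sL2_integrableM Lf (sL2_cst 1).
by apply: eq_integrable => // x _; rewrite /= mulr1.
Qed.

Lemma sL2_sip : semi_inner_product sL2 sdot.
Proof.
split.
- exact: (sL2_cst 0).
- move=> a f g Lf Lg; have [mf f2] := Lf; have [mg g2] := Lg; split.
    by apply: measurable_funD => //; apply: measurable_funM.
  have h := integrableD measurableT (integrableD measurableT
    (integrableZl measurableT (a ^+ 2) f2)
    (integrableZl measurableT (2 * a) (sL2_integrableM Lf Lg))) g2.
  apply: eq_integrable h => // x _ /=.
  rewrite -!EFinM -!EFinD; congr (_%:E); rewrite !fctE /=.
  have -> : a *: f x = a * f x by [].
  ring.
- by move=> f g; apply: eq_Rintegral => x _; rewrite mulrC.
- move=> a f g h Lf Lg Lh; rewrite /sdot -RintegralZl//; last exact: sL2_integrableM.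
  rewrite -RintegralD//.
  + by apply: eq_Rintegral => x _; rewrite /= mulrDl mulrA.
  + have := integrableZl measurableT a (sL2_integrableM Lf Lh).
    by apply: eq_integrable => // x _.
  + exact: sL2_integrableM.
- by move=> f _; apply: Rintegral_ge0 => x _; rewrite -expr2 sqr_ge0.
Qed.

Local Notation snorm := (seminorm_of sdot).

Lemma sdotE f g : sL2 f -> sL2 g -> (sdot f g)%:E = (\int[pi]_x (f x * g x)%:E)%E.
Proof.
move=> Lf Lg; rewrite /sdot /Rintegral fineK//.
by apply: integrable_fin_num => //; apply: sL2_integrableM.
Qed.

Lemma snorm_eq0 f : sL2 f -> (snorm f = 0 <-> f = cst 0 %[ae pi]).
Proof.
move=> Lf; have [mf f2] := Lf.
have e : (snorm f ^+ 2)%:E = (\int[pi]_x `|(f x ^+ 2)%:E|)%E.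
  rewrite (sqr_seminorm sL2_sip Lf) sdotE//; apply: eq_integral => x _.
  by rewrite gee0_abs -?expr2// lee_fin sqr_ge0.
have mf2 : measurable_fun setT (fun x => (f x ^+ 2)%:E).
  by apply/measurable_EFinP; apply: measurable_funX.
split.
- move=> f0; rewrite f0 expr0n/= in e.
  have := (ae_eq_integral_abs pi measurableT mf2).1 (esym e).
  apply: filterS => x /[apply] /= /eqP.
  by rewrite eqe sqrf_eq0 => /eqP.
- move=> f0; apply/eqP; rewrite -sqrf_eq0 -eqe e; apply/eqP.
  apply/(ae_eq_integral_abs pi measurableT mf2).
  by apply: filterS f0 => x /[apply] /= ->; rewrite expr0n.
Qed.

Lemma snorm_subr_eq0 f g : sL2 f -> sL2 g ->
  (snorm (f - g) = 0 <-> f = g %[ae pi]).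
Proof.
move=> Lf Lg; rewrite snorm_eq0; last exact: (sipB sL2_sip).
split; apply: filterS => x /[apply] /=.
  by move=> /eqP; rewrite subr_eq0 => /eqP.
by rewrite !fctE /= => ->; rewrite subrr.
Qed.

Lemma snorm_cst1 : snorm (cst 1) = 1.
Proof.
rewrite /seminorm_of /sdot /= mulr1 Rintegral_cst//= mul1r.
by rewrite [X in fine X]probability_setT /= sqrtr1.
Qed.

Lemma integral_norm_le_snorm f : sL2 f ->
  (\int[pi]_x (`|f x|)%:E <= (snorm f)%:E)%E.
Proof.
move=> Lf; have [mf f2] := Lf.
have Lnf : sL2 (fun x => `|f x|).
  split; first exact: measurableT_comp.
  by apply: eq_integrable f2 => // x _; rewrite real_normK ?num_real.
have := cauchy_schwarz sL2_sip Lnf (sL2_cst 1).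
rewrite snorm_cst1 mulr1.
have -> : snorm (fun x => `|f x|) = snorm f.
  congr Num.sqrt; apply: eq_Rintegral => x _.
  by rewrite -!expr2 real_normK ?num_real.
move=> /(le_trans (ler_norm _)); rewrite -lee_fin sdotE//; last exact: sL2_cst.
by under eq_integral do rewrite mulr1.
Qed.

End scalar_L2.

Section scalar_L2_complete.
Context {R : realType} {dT : measure_display} {T : measurableType dT}.
Variable pi : probability T R.
Local Notation sL2 := (sL2 pi).
Local Notation sdot := (sdot pi).
Local Notation snorm := (seminorm_of sdot).

(* By Tonelli the increments are absolutely summable almost everywhere, and
   Fatou's lemma bounds the distance to the pointwise limit. *)
Lemma sL2_complete : geometrically_complete sL2 sdot.
Proof.
refine (fun u : nat -> T -> R => _).
move=> C q q01 Lu uq; have /andP[q0 q1] := q01.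
have H := sL2_sip pi.
have mu n : measurable_fun setT (u n) := sL2_measurable (Lu n).
have C0 : 0 <= C by have := le_trans (seminorm_ge0 _) (uq 0%N); rewrite expr0 mulr1.
(* The sum of the geometric series: [D * q ^+ n] bounds the tail of the increments from [n] on. *)
pose D := C / (1 - q).
have D0 : 0 <= D by rewrite divr_ge0// subr_ge0 ltW.
have partial n k : \sum_(i < k) C * q ^+ (n + i) <= D * q ^+ n.
  have -> : \sum_(i < k) C * q ^+ (n + i) = (1 - q ^+ k) * (D * q ^+ n).
    elim: k => [|k IH]; first by rewrite big_ord0 expr0 subrr mul0r.
    rewrite big_ord_recr/= IH /D exprS exprD; field.
    by rewrite subr_eq0 gt_eqF.
  apply: ler_piMl; first by rewrite mulr_ge0 ?exprn_ge0.
  by rewrite gerBl exprn_ge0.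
have cauchy n k : snorm (u n - u (n + k)%N) <= D * q ^+ n.
  apply: le_trans (partial n k).
  elim: k => [|k IH].
    rewrite addn0 subrr big_ord0 -(scale0r (u n)) (seminormZ H) ?normr0 ?mul0r//.
  rewrite big_ord_recr/=; apply: le_trans (seminorm_triangle H (Lu n) (Lu (n + k)%N) (Lu _)) _.
  by apply: lerD => //; rewrite addnS (seminorm_sub H)//; exact: uq.
pose v k x := `|u k.+1 x - u k x|.
have mv k : measurable_fun setT (v k).
  rewrite /v; apply: measurableT_comp => //.
  by apply: measurable_funB; exact: mu.
pose G x : \bar R := (\sum_(0 <= k <oo) (v k x)%:E)%E.
have v0 k x : (0 <= (v k x)%:E)%E by rewrite lee_fin /v.
have intG : (\int[pi]_x G x < +oo)%E.
  rewrite /G integral_nneseries//; last by move=> k; exact/measurable_EFinP.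
  apply: (@le_lt_trans _ _ D%:E); last exact: ltry.
  apply: lime_le.
    by apply: is_cvg_nneseries => k _ _; apply: integral_ge0 => x _.
  apply: nearW => k.
  apply: (@le_trans _ _ (\sum_(0 <= i < k) (C * q ^+ i)%:E)%E).
    apply: lee_sum => i _.
    apply: le_trans (integral_norm_le_snorm (sipB H (Lu i.+1) (Lu i))) _.
    by rewrite lee_fin; apply: uq.
  rewrite sumEFin lee_fin big_mkord.
  by have := partial 0%N k; rewrite expr0 mulr1.
have mG : measurable_fun setT G.
  by apply: ge0_emeasurable_sum => // k _; exact/measurable_EFinP.
have G0 x : (0 <= G x)%E by apply: nneseries_ge0.
have aeG : {ae pi, forall x, setT x -> G x \is a fin_num}.
  apply: integrable_ae => //; apply/integrableP; split => //.
  by under eq_integral do rewrite gee0_abs//.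
have cvgu x : G x \is a fin_num -> cvgn (u ^~ x).
  move=> Gfin.
  have cv : cvgn (series (v ^~ x)).
    apply: nondecreasing_is_cvgn.
      by apply/nondecreasing_seqP => n; rewrite seriesSr lerDl /v.
    exists (fine (G x)) => _ [n _ <-].
    rewrite -lee_fin fineK// /series/= -sumEFin.
    exact: nneseries_lim_ge.
  have := @normed_cvg R R (telescope (u ^~ x)) cv.
  rewrite telescopeK => cw.
  have -> : u ^~ x = (fun n => (u n x - u 0%N x) + u 0%N x).
    by apply/funext => n; rewrite subrK.
  by apply: is_cvgD => //; apply: is_cvg_cst.
(* The upper limit is measurable everywhere and equals the limit wherever [G] is finite; [fine]
   replaces infinite values, which occur only on a null set. *)
pose w x : R := fine (limn_esup (fun n => (u n x)%:E)).
have mw : measurable_fun setT w.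
  apply: (@measurableT_comp _ _ _ _ _ _ (@fine R)) => //=.
  by apply: measurable_fun_limn_esup => n; exact/measurable_EFinP.
have cvgw x : G x \is a fin_num -> u n x @[n --> \oo] --> w x.
  move=> /cvgu /cvg_ex[l ul].
  have ul' : (u n x)%:E @[n --> \oo] --> l%:E by apply: cvg_EFin => //; exact: nearW.
  by rewrite /w (cvg_limn_einf_sup ul').2.
have bnd n : (\int[pi]_x ((u n x - w x) ^+ 2)%:E <= ((D * q ^+ n) ^+ 2)%:E)%E.
  pose h m x : \bar R := ((u n x - u m x) ^+ 2)%:E.
  have mh m : measurable_fun setT (h m).
    by apply/measurable_EFinP; apply: measurable_funX; apply: measurable_funB => //; exact: mu.
  apply: (@le_trans _ _ (\int[pi]_x limn_einf (h ^~ x))%E).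
    apply: ae_ge0_le_integral => //.
    - by move=> x _; rewrite lee_fin sqr_ge0.
    - by apply/measurable_EFinP; apply: measurable_funX; apply: measurable_funB => //; exact: mu.
    - move=> x _; rewrite limn_einf_lim; apply: lime_ge.
        exact: is_cvg_einfs.
      apply: nearW => m; apply: le_ereal_inf_tmp => _ [k _ <-].
      by rewrite lee_fin sqr_ge0.
    - rewrite (_ : (fun x => _) = (fun x => - limn_esup (fun m => - h m x))%E)//.
      apply: measurableT_comp => //; apply: measurable_fun_limn_esup => m.
      exact: measurableT_comp.
    - apply: filterS aeG => x /[apply] /cvgw ux.
      have hx : h m x @[m --> \oo] --> ((u n x - w x) ^+ 2)%:E.
        have c : u n x - u m x @[m --> \oo] --> u n x - w x.
          by apply: cvgB => //; apply: cvg_cst.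
        by apply: cvg_EFin; [exact: nearW|exact: (cvgM c c)].
      by rewrite (cvg_limn_einf_sup hx).1.
  apply: le_trans (fatou _ _ _ _) _ => //.
    by move=> m x _; rewrite lee_fin sqr_ge0.
  rewrite limn_einf_lim; apply: lime_le; first exact: is_cvg_einfs.
  apply: nearW => m.
  (* The index [n + m] is at least [m], so it lies in the tail, and at least [n], as [cauchy]
     requires. *)
  apply: ereal_inf_le; exists (\int[pi]_x h (n + m)%N x)%E.
    by exists (n + m)%N => //=; exact: leq_addl.
  have Lh := sipB H (Lu n) (Lu (n + m)%N).
  have Dq0 : 0 <= D * q ^+ n by rewrite mulr_ge0 ?exprn_ge0.
  have := cauchy n m; rewrite -(@ler_pXn2r _ 2) ?nnegrE ?seminorm_ge0//.
  by rewrite (sqr_seminorm H)// -lee_fin sdotE.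
have Lw n : sL2 (u n - w).
  split; first by apply: measurable_funB => //; exact: mu.
  apply/integrableP; split.
    by apply/measurable_EFinP; apply: measurable_funX; apply: measurable_funB => //; exact: mu.
  apply: (@le_lt_trans _ _ ((D * q ^+ n) ^+ 2)%:E); last exact: ltry.
  apply: le_trans (bnd n).
  by under eq_integral do rewrite gee0_abs ?lee_fin ?sqr_ge0//.
exists w.
  have := sipB H (Lu 0%N) (Lw 0%N).
  by rewrite opprB addrC subrK.
exists D => n; apply: (le_seminorm H) => //.
  by rewrite mulr_ge0 ?exprn_ge0.
by rewrite -lee_fin sdotE//; apply: bnd.
Qed.

End scalar_L2_complete.

(** * Mean-zero functions and centering *)

Section mean_zero.
Context {R : realType} {dT : measure_display} {T : measurableType dT}.
Variable pi : probability T R.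
Local Notation sL2 := (sL2 pi).
Local Notation sdot := (sdot pi).
Local Notation snorm := (seminorm_of sdot).
Let H := sL2_sip pi.
Implicit Types f g : T -> R.

Definition mean f : R := \int[pi]_x f x.

Definition sL20 : set (T -> R) := [set f : T -> R | sL2 f /\ mean f = 0].

Lemma meanE f : mean f = sdot f (cst 1).
Proof. by apply: eq_Rintegral => x _; rewrite /= mulr1. Qed.

Lemma mean_linear a f g : sL2 f -> sL2 g -> mean (a *: f + g) = a * mean f + mean g.
Proof. by move=> Lf Lg; rewrite !meanE (sip_linear H)//; exact: sL2_cst. Qed.

Lemma meanB f g : sL2 f -> sL2 g -> mean (f - g) = mean f - mean g.
Proof. by move=> Lf Lg; rewrite !meanE (ipBl H)//; exact: sL2_cst. Qed.

Lemma mean_cst c : mean (cst c) = c.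
Proof. by rewrite /mean Rintegral_cst// [X in fine X]probability_setT mulr1. Qed.

Lemma norm_mean_le f : sL2 f -> `|mean f| <= snorm f.
Proof.
move=> Lf; rewrite meanE; have := cauchy_schwarz H Lf (sL2_cst pi 1).
by rewrite snorm_cst1 mulr1.
Qed.

Lemma sL20_sL2 f : sL20 f -> sL2 f. Proof. by case. Qed.

Lemma sL20_sip : semi_inner_product sL20 sdot.
Proof.
split.
- by split; [exact: (sip0 H)|exact: mean_cst].
- move=> a f g [Lf f0] [Lg g0]; split; first exact: (sipPl H).
  by rewrite mean_linear// f0 g0 mulr0 addr0.
- exact: sipC H.
- by move=> a f g h [? _] [? _] [? _]; apply: (sip_linear H).
- by move=> f [? _]; apply: (sip_ge0 H).
Qed.

Lemma sL20_center f : sL2 f -> sL20 (f - cst (mean f)).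
Proof.
move=> Lf; split; first by apply: (sipB H) => //; exact: sL2_cst.
by rewrite meanB ?mean_cst ?subrr//; exact: sL2_cst.
Qed.

(** Centering projects orthogonally to the constants: the squared norm drops by [mean f ^+ 2]. *)
Lemma snorm_center_le f : sL2 f -> snorm (f - cst (mean f)) <= snorm f.
Proof.
move=> Lf; have [Lh h0] := sL20_center Lf; have L1 := sL2_cst pi 1.
have e : cst (mean f) = mean f *: cst 1 :> (T -> R).
  by apply/funext => x; rewrite /= -[LHS]mulr1.
have Lm := sipZ H (mean f) L1; rewrite e in Lh h0 *.
apply: (le_seminorm H) => //; first exact: seminorm_ge0.
rewrite (sqr_seminorm H)// (ipBl H Lf Lm Lh) (ipBr H Lf Lm Lf).
rewrite (ipZl H _ L1 Lh) (ipZr H _ L1 Lf) (sipC H (cst 1)) -!meanE h0.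
by rewrite mulr0 subr0 gerBl -expr2 sqr_ge0.
Qed.

End mean_zero.

Section L2norm.
Context {R : realType} {dT : measure_display} {T : measurableType dT}.
Variable pi : probability T R.
Local Notation sL2 := (sL2 pi).
Local Notation sdot := (sdot pi).
Local Notation snorm := (seminorm_of sdot).
Implicit Types f g : T -> R.

Lemma Lnorm2E g : measurable_fun setT g ->
  Lnorm pi 2%:E (fun x => (g x)%:E) = ((\int[pi]_x (g x ^+ 2)%:E) `^ 2^-1)%E.
Proof.
move=> mg; rewrite unlock; congr (_ `^ _)%E.
apply: eq_integral => x _; rewrite /= powR_mulrn//.
by rewrite real_normK ?num_real.
Qed.

Lemma finite_norm2P g : measurable_fun setT g ->
  finite_norm pi 2%:E g <-> sL2 g.
Proof.
move=> mg; rewrite /finite_norm -[X in Lnorm _ _ X]/(fun x => (g x)%:E) Lnorm2E//.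
have mg2 : measurable_fun setT (fun x => (g x ^+ 2)%:E).
  by apply/measurable_EFinP; apply: measurable_funX.
have e : (\int[pi]_x `|(g x ^+ 2)%:E| = \int[pi]_x (g x ^+ 2)%:E)%E.
  by apply: eq_integral => x _; rewrite gee0_abs// lee_fin sqr_ge0.
split=> [fin|[_ /integrableP[_]]]; last first.
  by rewrite e => fin; rewrite poweR_lty.
split => //; apply/integrableP; split => //; rewrite e.
rewrite ltey; apply/eqP => ey; move: fin; rewrite ey poweRyr//.
Qed.

Lemma fine_Lnorm2 g : sL2 g -> fine (Lnorm pi 2%:E (fun x => (g x)%:E)) = snorm g.
Proof.
move=> Lg; have [mg g2] := Lg; rewrite Lnorm2E//.
have <- : (sdot g g)%:E = (\int[pi]_x (g x ^+ 2)%:E)%E by rewrite sdotE.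
rewrite poweR_EFin /= /seminorm_of -powR12_sqrt//; exact: (sip_ge0 (sL2_sip pi)).
Qed.

End L2norm.

(** * Vector and complex square-integrable functions *)

Section vector_L2.
Context {R : realType} {dT : measure_display} {T : measurableType dT}.
Variable pi : probability T R.
Local Notation sL2 := (sL2 pi).
Local Notation sdot := (sdot pi).
Local Notation snorm := (seminorm_of sdot).

(** Serves both the Euclidean norm and the complex modulus, each the root of a sum of squares
    [s]. *)
Lemma L2norm_sqrt (V : Type) (nu : V -> R) (f : T -> V) (s : T -> R) :
  (forall x, nu (f x) = Num.sqrt (s x)) -> (forall x, 0 <= s x) ->
  measurable_fun setT s ->
  (finite_norm pi 2%:E (fun x => nu (f x)) <->
    pi.-integrable setT (fun x => (s x)%:E)) /\
  (pi.-integrable setT (fun x => (s x)%:E) ->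
    L2norm pi nu f = Num.sqrt (\int[pi]_x s x)).
Proof.
move=> nus s0 ms.
have mnu : measurable_fun setT (fun x => nu (f x)).
  rewrite (_ : (fun x => _) = (fun x => s x `^ 2^-1)).
    exact: (measurableT_comp (measurable_powR _)).
  by apply/funext => x; rewrite nus powR12_sqrt.
have e x : nu (f x) ^+ 2 = s x by rewrite nus sqr_sqrtr.
have eL2 : sL2 (fun x => nu (f x)) <-> pi.-integrable setT (fun x => (s x)%:E).
  by split=> [[_]|i]; [|split => //]; under eq_fun do rewrite ?e//.
split; first by rewrite finite_norm2P.
move=> /eL2 Lnu; rewrite /L2norm fine_Lnorm2// /seminorm_of; congr Num.sqrt.
by apply: eq_Rintegral => x _; rewrite -expr2 e.
Qed.

Definition vcoord (d : nat) (f : T -> 'cV[R]_d) (i : 'I_d) : T -> R := fun x => f x i 0.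

Section coordinates.
Context {d : nat}.
Implicit Types f g : T -> 'cV[R]_d.

Let measurable_sumsq f : vmeasurable f ->
  measurable_fun setT (fun x => \sum_(i < d) f x i 0 ^+ 2).
Proof.
by move=> mf; apply: measurable_sum => i; apply: measurable_funX; exact: mf.
Qed.

Let sumsq_ge0 f x : 0 <= \sum_(i < d) f x i 0 ^+ 2.
Proof. by apply: sumr_ge0 => i _; exact: sqr_ge0. Qed.

Lemma vL2P f : vL2 pi f <-> forall i, sL2 (vcoord f i).
Proof.
split.
- move=> [mf].
  rewrite (L2norm_sqrt (s := fun x => \sum_(i < d) f x i 0 ^+ 2) _ _ _).1//;
    last exact: measurable_sumsq.
  move=> fi i; split; first exact: mf.
  apply: le_integrable fi => //.
    by apply/measurable_EFinP; apply: measurable_funX; exact: mf.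
  move=> x _; rewrite /= lee_fin !ger0_norm ?sqr_ge0//.
  rewrite (bigD1 i)//= lerDl sumr_ge0// => j _; exact: sqr_ge0.
- move=> Lf.
  have mf : vmeasurable f by move=> i; case: (Lf i).
  split => //.
  apply/(L2norm_sqrt (s := fun x => \sum_(i < d) f x i 0 ^+ 2) _ _ _).1 => //; first exact: measurable_sumsq.
  under eq_fun do rewrite -sumEFin.
  by apply: integrable_sum => // i _; case: (Lf i).
Qed.

Lemma vdotE f g : vL2 pi f -> vL2 pi g ->
  vdot pi f g = \sum_(i < d) sdot (vcoord f i) (vcoord g i).
Proof.
move=> /vL2P Lf /vL2P Lg; apply: EFin_inj.
rewrite /vdot /Rintegral.
under eq_integral do rewrite -sumEFin.
rewrite integral_sum//; last by move=> i; exact: (sL2_integrableM (Lf i) (Lg i)).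
rewrite -sumEFin -[RHS]fineK; last by rewrite sumEFin.
by congr (fine _)%:E; apply: eq_bigr => i _; rewrite sdotE.
Qed.

Lemma vL2_sip : semi_inner_product (vL2 (d := d) pi) (vdot pi).
Proof.
have H := sL2_sip pi.
have LP a f g : vL2 pi f -> vL2 pi g -> vL2 pi (a *: f + g).
  move=> /vL2P Lf /vL2P Lg; apply/vL2P => i.
  rewrite (_ : vcoord _ i = a *: vcoord f i + vcoord g i).
    exact: (sipPl H).
  by apply/funext => x; rewrite /vcoord /= !mxE.
split.
- apply/vL2P => i; rewrite (_ : vcoord _ i = 0); first exact: (sip0 H).
  by apply/funext => x; rewrite /vcoord /= !mxE.
- exact: LP.
- move=> f g; rewrite /vdot; apply: eq_Rintegral => x _.
  by apply: eq_bigr => i _; rewrite mulrC.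
- move=> a f g h Lf Lg Lh; rewrite !vdotE//; last exact: LP.
  rewrite mulr_sumr -big_split/=; apply: eq_bigr => i _.
  have [/vL2P Lfi /vL2P Lgi /vL2P Lhi] := And3 Lf Lg Lh.
  rewrite -(sip_linear H)//.
  by congr sdot; apply/funext => x; rewrite /vcoord /= !mxE.
- move=> f _; apply: Rintegral_ge0 => x _; apply: sumr_ge0 => i _.
  by rewrite -expr2 sqr_ge0.
Qed.

Lemma L2norm_vdot f : vL2 pi f -> L2norm pi (@enorm R d) f = seminorm_of (vdot pi) f.
Proof.
move=> Lf; have [mf ff] := Lf; have ms := measurable_sumsq mf.
have [h1 h2] := L2norm_sqrt (nu := @enorm R d) (f := f) (fun x => erefl) (sumsq_ge0 f) ms.
rewrite h2; last exact/h1.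
congr Num.sqrt; apply: eq_Rintegral => x _.
Qed.

End coordinates.

Lemma cL2P (f : T -> R[i]) : cL2 pi f <->
  sL2 (fun x => complex.Re (f x)) /\ sL2 (fun x => complex.Im (f x)).
Proof.
pose s x := complex.Re (f x) ^+ 2 + complex.Im (f x) ^+ 2.
have s0 x : 0 <= s x by rewrite addr_ge0 ?sqr_ge0.
have e x : Normc.normc (f x) = Num.sqrt (s x) by rewrite /s; case: (f x).
split.
- move=> [mr mi].
  have ms : measurable_fun setT s by apply: measurable_funD; apply: measurable_funX.
  rewrite (L2norm_sqrt e s0 ms).1 => fi.
  split; split => //; apply: le_integrable fi => //.
  + by apply/measurable_EFinP; apply: measurable_funX.
  + by move=> x _; rewrite /= lee_fin !ger0_norm ?sqr_ge0// lerDl sqr_ge0.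
  + by apply/measurable_EFinP; apply: measurable_funX.
  + by move=> x _; rewrite /= lee_fin !ger0_norm ?sqr_ge0// lerDr sqr_ge0.
- move=> [[mr fr] [mi fi]].
  have ms : measurable_fun setT s by apply: measurable_funD; apply: measurable_funX.
  split => //; apply/(L2norm_sqrt e s0 ms).1.
  by have := integrableD measurableT fr fi; apply: eq_integrable.
Qed.

Lemma L2norm_normc (f : T -> R[i]) : cL2 pi f ->
  L2norm pi (@Normc.normc R) f ^+ 2 =
    snorm (fun x => complex.Re (f x)) ^+ 2 + snorm (fun x => complex.Im (f x)) ^+ 2.
Proof.
pose s x := complex.Re (f x) ^+ 2 + complex.Im (f x) ^+ 2.
have s0 x : 0 <= s x by rewrite addr_ge0 ?sqr_ge0.
have e x : Normc.normc (f x) = Num.sqrt (s x) by rewrite /s; case: (f x).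
move=> /cL2P[Lr Li]; have [mr fr] := Lr; have [mi fi] := Li.
have ms : measurable_fun setT s by apply: measurable_funD; apply: measurable_funX.
have si : pi.-integrable setT (fun x => (s x)%:E).
  by have := integrableD measurableT fr fi; apply: eq_integrable.
rewrite (L2norm_sqrt e s0 ms).2// sqr_sqrtr; last exact: Rintegral_ge0.
rewrite !(sqr_seminorm (sL2_sip pi))// /s RintegralD//.
Qed.

End vector_L2.

(** * Contraction on mean-zero functions *)

Section bounded_functions.
Context {R : realType} {dT : measure_display} {T : measurableType dT}.
Implicit Types f g : T -> R.

Definition unit_interval_fun : set (T -> R) :=
  [set g : T -> R | measurable_fun setT g /\ forall x, 0 <= g x <= 1].

Lemma indic_unit_interval (U : set T) : measurable U -> unit_interval_fun (\1_U).
Proof.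
move=> mU; split; first exact: measurable_indic.
by move=> x; rewrite indicE; case: (x \in U); rewrite /= ?lexx ?ler01.
Qed.

(* Any [g] with values in [0, 1] is the half sum of the indicator of
   [g >= 1/2] and of another such function, so that iterating halves the
   contribution of the crude bound [C]. *)
Lemma unit_interval_functional_bound (Phi : (T -> R) -> R) (e C : R) :
  (forall U g, measurable U -> unit_interval_fun g ->
    Phi (fun x => (\1_U x + g x) / 2) = (Phi (\1_U) + Phi g) / 2) ->
  (forall g, unit_interval_fun g -> `|Phi g| <= C) ->
  (forall U, measurable U -> `|Phi (\1_U)| <= e) ->
  forall g, unit_interval_fun g -> `|Phi g| <= e.
Proof.
move=> PhiD PhiC Phie.
suff main n g : unit_interval_fun g -> `|Phi g| <= e + C * 2^-1 ^+ n.
  move=> g ug; rewrite -subr_le0; apply: (@le0_geometric _ _ C (2^-1)).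
    by rewrite invr_ge0 ler0n invf_lt1// ltr1n.
  by move=> n; rewrite lerBlDl; apply: main.
elim: n g => [|n IH] g ug; have [mg g01] := ug.
  rewrite expr0 mulr1; apply: le_trans (PhiC _ ug) _.
  rewrite lerDr; apply: le_trans (Phie set0 measurable0); exact: normr_ge0.
pose U := g @^-1` `[2^-1, +oo[.
have mU : measurable U by rewrite -[U]setTI; apply: mg.
pose g' x := 2 * g x - \1_U x.
have ug' : unit_interval_fun g'.
  split.
    apply: measurable_funB; last exact: measurable_indic.
    by apply: measurable_funM.
  move=> x; rewrite /g' indicE; have /andP[g0 g1] := g01 x.
  case: (boolP (x \in U)) => xU /=.
    have : 2^-1 <= g x by move: xU; rewrite inE /U /= in_itv/= andbT.
    by move=> h; apply/andP; split; lra.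
  have : g x < 2^-1.
    rewrite ltNge; apply: contra xU => h.
    by rewrite inE /U /= in_itv/= andbT.
  by move=> h; apply/andP; split; lra.
have -> : g = (fun x => (\1_U x + g' x) / 2).
  by apply/funext => x; rewrite /g' addrC subrK mulrAC divff ?mul1r// pnatr_eq0.
rewrite PhiD// normrM (@ger0_norm _ 2^-1)// ler_pdivrMr//.
apply: le_trans (ler_normD _ _) _.
have h1 := Phie U mU; have h2 := IH g' ug'.
rewrite exprS; lra.
Qed.

Lemma bounded_integrable (mu : {measure set T -> \bar R}) f B :
  (mu setT = 1)%E -> measurable_fun setT f -> (forall x, `|f x| <= B) ->
  mu.-integrable setT (fun x => (f x)%:E).
Proof.
move=> mu1 mf fB.
have i : mu.-integrable setT (cst B%:E).
  apply/integrableP; split; first exact: measurable_cst.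
  by rewrite integral_cst// mu1 mule1 ltry.
apply: le_integrable i => //; first exact/measurable_EFinP.
by move=> x _; rewrite /= lee_fin; apply: le_trans (fB x) (ler_norm _).
Qed.

Lemma unit_interval_norm g x : unit_interval_fun g -> `|g x| <= 1.
Proof. by move=> [_ /(_ x) /andP[g0 g1]]; rewrite ger0_norm. Qed.

Section unit_mass.
Variable mu : {measure set T -> \bar R}.
Hypothesis mu1 : (mu setT = 1)%E.

Lemma Rintegral_cst1 c : \int[mu]__ c = c.
Proof. by rewrite Rintegral_cst// [X in fine X]mu1 mulr1. Qed.

Lemma Rintegral_indic (U : set T) : measurable U -> \int[mu]_x (\1_U x) = fine (mu U).
Proof. by move=> mU; rewrite /Rintegral integral_indic// setIT. Qed.

Lemma norm_Rintegral_le f B : measurable_fun setT f -> (forall x, `|f x| <= B) ->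
  `|\int[mu]_x f x| <= B.
Proof.
move=> mf fB; have fi := bounded_integrable mu1 mf fB.
apply: le_trans (le_normr_Rintegral measurableT fi) _.
rewrite -[leRHS]Rintegral_cst1; apply: le_Rintegral => //.
  exact: integrable_norm.
by apply: (@bounded_integrable _ _ `|B|) => //; exact: measurable_cst.
Qed.

Lemma Rintegral_half_sum g h : unit_interval_fun g -> unit_interval_fun h ->
  \int[mu]_x ((g x + h x) / 2) = (\int[mu]_x g x + \int[mu]_x h x) / 2.
Proof.
move=> ug uh.
have gi := bounded_integrable mu1 ug.1 (fun x => unit_interval_norm x ug).
have hi := bounded_integrable mu1 uh.1 (fun x => unit_interval_norm x uh).
rewrite RintegralZr// ?RintegralD//.
exact: (integrableD measurableT gi hi).
Qed.

Lemma Rintegral_affine f B c : measurable_fun setT f -> (forall x, `|f x| <= B) ->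
  \int[mu]_x ((f x + c) / (2 * c)) = (\int[mu]_x f x + c) / (2 * c).
Proof.
move=> mf fB; have fi := bounded_integrable mu1 mf fB.
have ci : mu.-integrable setT (fun _ : T => c%:E).
  by apply: (@bounded_integrable _ _ `|c|) => //; exact: measurable_cst.
rewrite RintegralZr// ?RintegralD ?Rintegral_cst1//.
exact: (integrableD measurableT fi ci).
Qed.

End unit_mass.

Lemma affine_unit_interval f B : 0 < B -> measurable_fun setT f ->
  (forall x, `|f x| <= B) -> unit_interval_fun (fun x => (f x + B) / (2 * B)).
Proof.
move=> B0 mf fB; split.
  by apply: measurable_funM => //; apply: measurable_funD.
move=> x; have := fB x; rewrite ler_norml => /andP[l u].
by rewrite ler_pdivrMr ?mulr_gt0// ler_pdivlMr ?mulr_gt0//; apply/andP; split; lra.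
Qed.

(** Total variation controls indicators only. The map [(f + B) / (2 * B)] brings [f] into [0, 1],
    where the half-sum decomposition applies to the difference of the two integrals; undoing the
    scaling costs the factor [2 * B]. *)
Lemma total_variation_integral (mu nu : {measure set T -> \bar R}) f (B e : R) :
  (mu setT = 1)%E -> (nu setT = 1)%E ->
  (forall U, measurable U -> (`|mu U - nu U| <= e%:E)%E) ->
  measurable_fun setT f -> 0 < B -> (forall x, `|f x| <= B) ->
  `|\int[mu]_x f x - \int[nu]_x f x| <= 2 * B * e.
Proof.
move=> mu1 nu1 tv mf B0 fB.
pose Phi g := \int[mu]_x g x - \int[nu]_x g x.
have ug := affine_unit_interval B0 mf fB.
have fin_mu (m : {measure set T -> \bar R}) U : (m setT = 1)%E -> measurable U -> m U \is a fin_num.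
  move=> m1 mU; rewrite ge0_fin_numE//; apply: (@le_lt_trans _ _ 1%E); last exact: ltry.
  by rewrite -m1 le_measure ?inE.
have : `|Phi (fun x => (f x + B) / (2 * B))| <= e.
  apply: (@unit_interval_functional_bound Phi e 2) => //.
  - move=> U g mU ug'; have uU := indic_unit_interval mU.
    by rewrite /Phi !Rintegral_half_sum//; lra.
  - move=> g ug'; apply: le_trans (ler_normB _ _) _.
    rewrite (_ : 2 = 1 + 1)//; apply: lerD; apply: norm_Rintegral_le => //.
    + exact: ug'.1.
    + by move=> x; apply: unit_interval_norm.
    + exact: ug'.1.
    + by move=> x; apply: unit_interval_norm.
  - move=> U mU; rewrite /Phi !Rintegral_indic// -lee_fin.
    by have := tv U mU; rewrite -{1}(fineK (fin_mu _ _ mu1 mU)) -{1}(fineK (fin_mu _ _ nu1 mU)).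
rewrite /Phi !(Rintegral_affine _ B mf fB)// -mulrBl.
rewrite (_ : _ + B - _ = \int[mu]_x f x - \int[nu]_x f x); last by ring.
rewrite normrM normfV (@ger0_norm _ (2 * B)); last by rewrite mulr_ge0 ?ltW.
by rewrite ler_pdivrMr ?mulr_gt0// mulrC.
Qed.

End bounded_functions.

(** * The Markov operator on bounded functions *)

Section markov_operator.
Context {R : realType} {dT : measure_display} {T : measurableType dT}.
Variables (P : R.-pker T ~> T) (pi : probability T R).
Implicit Types f g : T -> R.

Definition sP f : T -> R := fun x => \int[P x]_y f y.

Lemma sP_cst c : sP (cst c) = cst c.
Proof. by apply/funext => x; rewrite /sP Rintegral_cst1// prob_kernel. Qed.

(** [kpow] is typed as a sub-probability kernel only, so its unit mass has to be derived. *)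
Lemma kpow1 n x : (kpow P n x setT = 1)%E.
Proof.
elim: n x => [|n IH] x; first exact: diracT.
rewrite [LHS](_ : _ = \int[P x]_y kpow P n y setT)%E//.
by under eq_integral do rewrite IH; rewrite integral_cst// mul1e prob_kernel.
Qed.

Definition kP (n : nat) f : T -> R := fun x => \int[kpow P n x]_y f y.

(** Adding [B] reduces to nonnegative integrands; unit mass turns the shift into the constant [B],
    which is then subtracted. *)
Lemma measurable_kernel_integral (k : T -> {measure set T -> \bar R}) f B :
  (forall U, measurable U -> measurable_fun setT (k ^~ U)) ->
  (forall x, k x setT = 1)%E ->
  measurable_fun setT f -> (forall x, `|f x| <= B) ->
  measurable_fun setT (fun x => \int[k x]_y f y).
Proof.
move=> mk k1 mf fB.
have -> : (fun x => \int[k x]_y f y) = (fun x => fine (\int[k x]_y (f y + B)%:E)%E - B).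
  apply/funext => x; have fi := bounded_integrable (k1 x) mf fB.
  have -> : fine (\int[k x]_y (f y + B)%:E)%E = \int[k x]_y (f y + B) by [].
  rewrite RintegralD ?Rintegral_cst1 ?addrK//.
  by apply: (@bounded_integrable _ _ _ _ _ `|B|) => //; exact: measurable_cst.
apply: measurable_funB => //.
apply: (@measurableT_comp _ _ _ _ _ _ (@fine R)) => //.
apply: measurable_fun_integral_kernel => //.
  move=> y; rewrite lee_fin -lerBlDr sub0r.
  by have := fB y; rewrite ler_norml => /andP[].
by apply/measurable_EFinP; apply: measurable_funD.
Qed.

Lemma measurable_sP f B : measurable_fun setT f -> (forall x, `|f x| <= B) ->
  measurable_fun setT (sP f).
Proof.
apply: measurable_kernel_integral => [U mU|x]; first exact: measurable_kernel.
exact: prob_kernel.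
Qed.

Lemma measurable_kP n f B : measurable_fun setT f -> (forall x, `|f x| <= B) ->
  measurable_fun setT (kP n f).
Proof.
apply: measurable_kernel_integral => [U mU|x]; first exact: measurable_kernel.
exact: kpow1.
Qed.

Lemma kP_bound n f B : measurable_fun setT f -> (forall x, `|f x| <= B) ->
  forall x, `|kP n f x| <= B.
Proof. by move=> mf fB x; apply: norm_Rintegral_le => //; exact: kpow1. Qed.

Lemma sP_bound f B : measurable_fun setT f -> (forall x, `|f x| <= B) ->
  forall x, `|sP f x| <= B.
Proof. by move=> mf fB x; apply: norm_Rintegral_le => //; exact: prob_kernel. Qed.

(** On indicators this is the definition of the composed kernel. The half-sum decomposition with
    error 0 extends it to functions with values in [0, 1]. *)
Lemma kPS_unit_interval n g : unit_interval_fun g -> kP n.+1 g = sP (kP n g).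
Proof.
move=> ug; apply/funext => x; apply/eqP; rewrite -subr_eq0 -normr_le0.
pose Phi g := kP n.+1 g x - sP (kP n g) x.
have b g' : unit_interval_fun g' -> forall x, `|g' x| <= 1.
  by move=> ug' y; apply: unit_interval_norm.
have mk g' : unit_interval_fun g' -> measurable_fun setT (kP n g').
  by move=> ug'; apply: measurable_kP ug'.1 (b _ ug').
have ki g' : unit_interval_fun g' -> (P x).-integrable setT (fun y => (kP n g' y)%:E).
  move=> ug'; apply: (@bounded_integrable _ _ _ _ _ 1).
  - exact: prob_kernel.
  - exact: mk.
  - exact: kP_bound ug'.1 (b _ ug').
apply: (@unit_interval_functional_bound _ _ _ Phi 0 2) => //.
- move=> U g' mU ug'; have uU : unit_interval_fun (\1_U : T -> R) by exact: indic_unit_interval.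
  rewrite /Phi /kP Rintegral_half_sum//; last exact: kpow1.
  rewrite -/(kP _ _) [X in _ - X = _](_ : _ = (sP (kP n \1_U) x + sP (kP n g') x) / 2).
    by rewrite /kP; lra.
  rewrite /sP -RintegralD//; try exact: ki.
  rewrite -RintegralZr//.
    by apply: eq_Rintegral => y _; rewrite /kP Rintegral_half_sum//; exact: kpow1.
  have := integrableD measurableT (ki _ uU) (ki _ ug').
  by apply: eq_integrable.
- move=> g' ug'; apply: le_trans (ler_normB _ _) _.
  rewrite (_ : 2 = 1 + 1)//; apply: lerD.
    exact: kP_bound ug'.1 (b _ ug') _.
  apply: sP_bound; first exact: mk.
  exact: kP_bound ug'.1 (b _ ug').
- move=> U mU; rewrite /Phi /kP Rintegral_indic//.
  rewrite [X in fine X](_ : _ = \int[P x]_y kpow P n y U)%E//.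
  suff -> : sP (fun y => \int[kpow P n y]_z \1_U z) x = fine (\int[P x]_y kpow P n y U)%E.
    by rewrite subrr normr0.
  rewrite /sP /Rintegral; congr fine; apply: eq_integral => y _.
  rewrite integral_indic// setIT fineK// ge0_fin_numE//.
  apply: (@le_lt_trans _ _ 1%E); last exact: ltry.
  by rewrite -(kpow1 n y) le_measure ?inE.
Qed.

Lemma kPS n f B : 0 < B -> measurable_fun setT f -> (forall x, `|f x| <= B) ->
  kP n.+1 f = sP (kP n f).
Proof.
move=> B0 mf fB; have ug := affine_unit_interval B0 mf fB.
have e m : kP m (fun x => (f x + B) / (2 * B)) = (fun x => (kP m f x + B) / (2 * B)).
  by apply/funext => x; rewrite /kP (Rintegral_affine _ B mf fB)//; exact: kpow1.
have := kPS_unit_interval n ug; rewrite !e.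
have -> : sP (fun x => (kP n f x + B) / (2 * B)) = (fun x => (sP (kP n f) x + B) / (2 * B)).
  apply/funext => x; rewrite /sP (Rintegral_affine _ B (measurable_kP n mf fB) (kP_bound n mf fB))//.
  exact: prob_kernel.
move=> h; apply/funext => x; move/(congr1 (fun k => k x)) : h => /=.
have B20 : 2 * B != 0 by rewrite mulf_neq0 ?pnatr_eq0// gt_eqF.
by move=> /(mulIf (invr_neq0 B20)) /addIr.
Qed.

Lemma kP_iter n f B : 0 < B -> measurable_fun setT f -> (forall x, `|f x| <= B) ->
  kP n f = iter n sP f.
Proof.
move=> B0 mf fB; elim: n => [|n IH]; last by rewrite (kPS n B0 mf fB) IH.
apply/funext => x; rewrite /kP /= /Rintegral integral_dirac//.
  by rewrite diracT mul1e.
exact/measurable_EFinP.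
Qed.

Lemma uniformly_ergodic_tv e : uniformly_ergodic P pi -> 0 < e ->
  exists2 m, (0 < m)%N & forall x U, measurable U ->
    (`|kpow P m x U - pi U| <= e%:E)%E.
Proof.
move=> erg e0.
have /fine_cvgP[fin cv] := erg.
have [N _ HN] : \forall n \near \oo,
    (ereal_sup (range (fun x => tv_dist (kpow P n x) pi)) <= e%:E)%E.
  have cv' : \forall n \near \oo,
      fine (ereal_sup (range (fun x => tv_dist (kpow P n x) pi))) < e.
    exact: (cvgr_lt _ cv).
  near=> n; rewrite -[leLHS]fineK; last by near: n.
  by rewrite lee_fin ltW//; near: n.
(* The successor guarantees a positive power, as the iterate bound requires. *)
exists N.+1 => // x U mU.
apply: le_trans (HN N.+1 (leqnSn N)).
apply: (@le_trans _ _ (tv_dist (kpow P N.+1 x) pi)).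
  by apply: ereal_sup_ubound; exists U.
by apply: ereal_sup_ubound; exists x.
Unshelve. all: by end_near. Qed.

End markov_operator.

(** * From sup-norm decay to an L^2 contraction *)

Section contraction.
Context {R : realType} {dT : measure_display} {T : measurableType dT}.
Variables (P : R.-pker T ~> T) (pi : probability T R).
Local Notation sL2 := (sL2 pi).
Local Notation sL20 := (sL20 pi).
Local Notation sdot := (sdot pi).
Local Notation snorm := (seminorm_of sdot).
Local Notation mean := (mean pi).
Local Notation sP := (sP P).
Let H := sL2_sip pi.
Implicit Types f g : T -> R.

Lemma bernoulli_lower (d : R) n : 0 <= d <= 1 -> 1 - n%:R * d <= (1 - d) ^+ n.
Proof.
move=> /andP[d0 d1]; elim: n => [|n IH]; first by rewrite mul0r subr0 expr0.
rewrite exprS; have : (1 - d) * (1 - n%:R * d) <= (1 - d) * (1 - d) ^+ n.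
  by rewrite ler_wpM2l// subr_ge0.
have : 0 <= n%:R * d * d by rewrite !mulr_ge0.
rewrite -[n.+1]addn1 natrD; lra.
Qed.

Lemma snorm_le_bound f B : measurable_fun setT f -> (forall x, `|f x| <= B) ->
  0 <= B -> snorm f <= B.
Proof.
move=> mf fB B0; have Lf : sL2 f by apply: bounded_sL2 fB.
apply: (le_seminorm H) => //.
have b x : `|f x * f x| <= B ^+ 2.
  by rewrite normrM expr2 ler_pM.
apply: le_trans (ler_norm _) _.
apply: norm_Rintegral_le => //; first exact: probability_setT.
exact: measurable_funM.
Qed.

(** The space on which uniform ergodicity gives decay of iterates. It is stable under P but not
    complete, which does no harm since the log-convexity argument takes no limits of vectors. *)
Definition bounded0 : set (T -> R) :=
  [set f : T -> R | [/\ measurable_fun setT f, mean f = 0 &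
    exists2 B, 0 < B & forall x, `|f x| <= B]].

Lemma bounded0_sL20 f : bounded0 f -> sL20 f.
Proof. by move=> [mf f0 [B B0 fB]]; split => //; apply: bounded_sL2 fB. Qed.

Lemma bounded0_sip : semi_inner_product bounded0 sdot.
Proof.
have H0 := sL20_sip pi.
split.
- split; [exact: measurable_cst|exact: mean_cst|exists 1 => // x].
  by rewrite normr0.
- move=> a f g Lf Lg; have [_ m0] := sipPl H0 a (bounded0_sL20 Lf) (bounded0_sL20 Lg).
  have [mf _ [B B0 fB]] := Lf; have [mg _ [C C0 gC]] := Lg.
  split => //; first by apply: measurable_funD => //; apply: measurable_funM.
  exists (`|a| * B + C) => [|x]; first by rewrite ltr_wpDl// mulr_ge0// ltW.
  apply: le_trans (ler_normD _ _) _; apply: lerD => //.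
  by rewrite normrM ler_wpM2l.
- exact: sipC H.
- move=> a f g h /bounded0_sL20[? _] /bounded0_sL20[? _] /bounded0_sL20[? _].
  exact: (sip_linear H).
- by move=> f /bounded0_sL20[? _]; apply: (sip_ge0 H).
Qed.

Hypothesis HP : selfadjoint sL2 sdot sP.

(** Invariance of the mean comes from symmetry: [<P f, 1> = <f, P 1> = <f, 1>]. *)
Lemma mean_sP f : sL2 f -> mean (sP f) = mean f.
Proof. by move=> Lf; rewrite !meanE HP.2 ?sP_cst//; exact: sL2_cst. Qed.

Lemma sL20_selfadjoint : selfadjoint sL20 sdot sP.
Proof.
split.
  by move=> f [Lf f0]; split; [exact: HP.1|rewrite mean_sP].
by move=> f g [? _] [? _]; apply: HP.2.
Qed.

Lemma bounded0_selfadjoint : selfadjoint bounded0 sdot sP.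
Proof.
split.
- move=> f Lf; have [_ m0] := sL20_selfadjoint.1 _ (bounded0_sL20 Lf).
  have [mf _ [B B0 fB]] := Lf; split => //; first exact: measurable_sP fB.
  by exists B => //; exact: sP_bound.
- by move=> f g /bounded0_sL20[? _] /bounded0_sL20[? _]; apply: HP.2.
Qed.

Hypothesis erg : uniformly_ergodic P pi.

Lemma bounded0_contraction : exists2 r : R, 0 < r < 1 &
  forall f, bounded0 f -> snorm (sP f) <= r * snorm f.
Proof.
(* With 1/4, the bound [2 * B * e] for a mean-zero function is [B / 2]. *)
have [m m0 tv] := uniformly_ergodic_tv (e := 4^-1) erg ltac:(by rewrite invr_gt0).
have half f B : 0 < B -> measurable_fun setT f -> mean f = 0 ->
    (forall x, `|f x| <= B) -> forall x, `|iter m sP f x| <= B / 2.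
  move=> B0 mf f0 fB x; rewrite -(kP_iter P m B0 mf fB).
  have := total_variation_integral (kpow1 P m x) (@probability_setT _ _ _ pi) (tv x) mf B0 fB.
  rewrite -/(mean f) f0 subr0 -/(kP _ _ _ _) => /le_trans; apply.
  by lra.
(* Chosen so that Bernoulli's inequality gives [(1 - d) ^+ m >= 1 - m * d = 1/2]: the halving every
   [m] steps is then dominated by the rate [1 - d] per step. *)
pose d : R := (2 * m%:R)^-1.
have m1 : 1 <= m%:R :> R by rewrite ler1n.
have d0 : 0 < d by rewrite invr_gt0 mulr_gt0// ltr0n.
have d1 : d <= 2^-1 by rewrite /d lef_pV2 ?posrE//; lra.
have dm : m%:R * d = 2^-1 by rewrite /d invfM mulrCA divff ?mulr1// gt_eqF// ltr0n.
exists (1 - d); first by apply/andP; split; lra.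
move=> f Lf; have [mf f0 [B B0 fB]] := Lf.
apply: (selfadjoint_iterate_bound bounded0_sip bounded0_selfadjoint (m := m) (C := B)) => //.
  by lra.
move=> k.
have Lk n : bounded0 (iter n sP f) by apply: selfadjoint_iter bounded0_selfadjoint _ _ Lf.
have geo x : `|iter (m * k) sP f x| <= B * 2^-1 ^+ k.
  elim: k x => [|k IH] x; first by rewrite muln0 expr0 mulr1.
  rewrite mulnS iterD exprSr mulrA.
  have [mk k0 _] := Lk (m * k)%N.
  by apply: half => //; rewrite mulr_gt0// exprn_gt0.
have [mk _ _] := Lk (m * k)%N.
have pk : 0 <= B * 2^-1 ^+ k by rewrite mulr_ge0 ?exprn_ge0// ltW.
apply: le_trans (snorm_le_bound mk geo pk) _.
rewrite ler_pM2l// exprM lerXn2r ?nnegrE//.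
  by rewrite exprn_ge0//; lra.
have := @bernoulli_lower d m; rewrite dm => h.
apply: le_trans (h _); last by apply/andP; split; lra.
by lra.
Qed.

Let truncate f (j : nat) : T -> R := fun x => f x * \1_([set y | `|f y| <= j%:R]) x.

Lemma measurable_truncate f j : measurable_fun setT f ->
  measurable_fun setT (truncate f j).
Proof.
move=> mf; apply: measurable_funM => //; apply: measurable_indic.
have mnf : measurable_fun setT (fun y => `|f y|) by apply: measurableT_comp.
rewrite (_ : [set y | _] = setT `&` (fun y => `|f y|) @^-1` `]-oo, j%:R]).
  by apply: mnf => //; exact: measurable_itv.
by apply/seteqP; split => y /=; rewrite in_itv/= => // -[].
Qed.

Lemma truncate_sq_cvg f : measurable_fun setT f ->
  (\int[pi]_x ((truncate f n x) ^+ 2)%:E @[n --> \oo] --> \int[pi]_x ((f x) ^+ 2)%:E)%E.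
Proof.
move=> mf.
have trE n x : truncate f n x = if `|f x| <= n%:R then f x else 0.
  rewrite /truncate indicE; case: ifPn => fn.
    by rewrite mem_set//= mulr1.
  by rewrite memNset ?mulr0//=; exact/negP.
have lim x : ((truncate f n x) ^+ 2)%:E @[n --> \oo] --> ((f x) ^+ 2)%:E.
  apply: cvg_near_cst; near=> n; rewrite trE ifT//.
  by near: n; exact: nbhs_infty_ger.
rewrite [X in _ --> X](_ : _ = \int[pi]_x limn (fun n => ((truncate f n x) ^+ 2)%:E))%E.
  apply: cvg_monotone_convergence => //.
  - by move=> n; apply/measurable_EFinP; apply: measurable_funX; exact: measurable_truncate.
  - by move=> n x _; rewrite lee_fin sqr_ge0.
  - move=> x _ a b ab; rewrite lee_fin !trE.
    case: ifPn => fa; last by rewrite expr0n sqr_ge0.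
    by rewrite ifT// (le_trans fa)// ler_nat.
apply: eq_integral => x _; apply/esym/cvg_lim => //.
Unshelve. all: by end_near. Qed.

(** Duality replaces a density argument. For [h = P f] and [t] a truncation of [h],
    [‖t‖² = <h, t> = <h, t - mean t>] because [h] has mean 0, and this equals [<f, P (t - mean t)>],
    at most [r ‖f‖ ‖t‖] by the bounded case. Monotone convergence removes the truncation. *)
Lemma sP_contraction : exists2 r : R, 0 < r < 1 &
  forall f, sL20 f -> snorm (sP f) <= r * snorm f.
Proof.
have [r r01 Hr] := bounded0_contraction; exists r => // f Lf; have /andP[r0 r1] := r01.
have Lh := sL20_selfadjoint.1 _ Lf; set h := sP f in Lh *.
have [Lh2 h0] := Lh; have [mh _] := Lh2.
have mt j : measurable_fun setT (truncate h j) by apply: measurable_truncate.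
have tb j x : `|truncate h j x| <= j%:R + 1.
  rewrite /truncate indicE; case: (boolP (x \in _)) => /= xj; last first.
    by rewrite mulr0 normr0.
  by move: xj; rewrite mulr1 inE/=; lra.
have Lt j : sL2 (truncate h j) by apply: bounded_sL2 (tb j).
have tt j : snorm (truncate h j) <= r * snorm f.
  have [->|t0] := eqVneq (snorm (truncate h j)) 0.
    by rewrite mulr_ge0 ?seminorm_ge0// ltW.
  have {}t0 : 0 < snorm (truncate h j) by rewrite lt_def t0 seminorm_ge0.
  rewrite -(ler_pM2r t0) -expr2 (sqr_seminorm H)//.
  pose g := truncate h j - cst (mean (truncate h j)).
  have Lg0 : sL20 g by apply: sL20_center.
  have [Lg g0] := Lg0.
  have Lc := sL2_cst pi (mean (truncate h j)).
  have bg : bounded0 g.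
    split => //; first by case: Lg.
    exists (j%:R + 1 + `|mean (truncate h j)|) => [|x].
      by rewrite ltr_wpDr// ltr_wpDl.
    by apply: le_trans (ler_normB _ _) _; apply: lerD.
  have -> : sdot (truncate h j) (truncate h j) = sdot h g.
    rewrite (ipBr H)//.
    have -> : sdot h (cst (mean (truncate h j))) = 0.
      rewrite [LHS](_ : _ = mean (truncate h j) * mean h); last first.
        rewrite /mean -RintegralZl//; last exact: sL2_integrable.
        by apply: eq_Rintegral => x _; rewrite mulrC.
      by rewrite h0 mulr0.
    rewrite subr0; apply: eq_Rintegral => x _.
    by rewrite /truncate indicE; case: (x \in _); rewrite ?mulr1 ?mulr0.
  rewrite HP.2//; last by case: Lf.
  apply: le_trans (ler_norm _) _.
  apply: le_trans (cauchy_schwarz H _ _) _ => //; first by case: Lf.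
    by apply: HP.1.
  rewrite mulrAC mulrC ler_wpM2r ?seminorm_ge0//.
  apply: le_trans (Hr _ bg) _; rewrite ler_pM2l//.
  exact: snorm_center_le.
apply: (le_seminorm H) => //.
  by rewrite mulr_ge0 ?seminorm_ge0// ltW.
rewrite -lee_fin sdotE//.
under eq_integral do rewrite -expr2.
have cv := truncate_sq_cvg mh.
rewrite -(cvg_lim (@ereal_hausdorff R) cv).
apply: lime_le; first by apply/cvg_ex; eexists; exact: cv.
apply: nearW => j.
have -> : (\int[pi]_x (truncate h j x ^+ 2)%:E = (sdot (truncate h j) (truncate h j))%:E)%E.
  by rewrite sdotE//; apply: eq_integral => x _; rewrite expr2.
rewrite lee_fin -(sqr_seminorm H)// ler_pXn2r ?nnegrE ?seminorm_ge0//.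
by rewrite mulr_ge0 ?seminorm_ge0// ltW.
Qed.

End contraction.

(** * The spectrum *)

Section spectrum.
Context {R : realType} {dT : measure_display} {T : measurableType dT}.
Variables (P : R.-pker T ~> T) (pi : probability T R).
Local Notation sL2 := (sL2 pi).
Local Notation sL20 := (sL20 pi).
Local Notation sdot := (sdot pi).
Local Notation snorm := (seminorm_of sdot).
Local Notation cL2 := (cL2 pi).
Local Notation cnorm := (L2norm pi (@Normc.normc R)).
Local Notation pnorm := (seminorm_of (pair_ip sdot)).
Let H := sL2_sip pi.
Let H2 := pair_sip (sL2_sip pi).

Hypothesis HP : selfadjoint sL2 sdot (sP P).

(** Up to seminorm 0, deflating P amounts to centering [f] before applying P, and centering does not
    increase the norm. *)
Lemma deflate_sP_le (r : R) : 0 <= r ->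
  (forall f, sL20 f -> snorm (sP P f) <= r * snorm f) ->
  forall f, sL2 f -> snorm (deflate sdot (sP P) (cst 1) f) <= r * snorm f.
Proof.
move=> r0 Hr f Lf; have L1 := sL2_cst pi 1.
have e := selfadjoint_linear H HP (- mean pi f) L1 Lf.
have c : - mean pi f *: cst 1 + f = f - cst (mean pi f) :> (T -> R).
  rewrite addrC; congr (_ + _); apply/funext => x.
  by rewrite /= -[RHS]mulr1.
have Lc := sL20_center Lf.
have dE : deflate sdot (sP P) (cst 1) f = - mean pi f *: sP P (cst 1) + sP P f.
  by rewrite sP_cst /deflate -meanE scaleNr addrC.
rewrite dE; rewrite c in e.
have LQ : sL2 (- mean pi f *: sP P (cst 1) + sP P f).
  by apply: (sipPl H); apply: HP.1.
rewrite -(seminorm_eq H _ LQ e); last by apply: HP.1; exact: sL20_sL2.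
apply: le_trans (Hr _ Lc) _; rewrite ler_wpM2l//.
exact: snorm_center_le.
Qed.

Definition ofC (f : T -> R[i]) : (T -> R) * (T -> R) :=
  (fun x => complex.Re (f x), fun x => complex.Im (f x)).

Definition toC (p : (T -> R) * (T -> R)) : T -> R[i] := fun x => Complex (p.1 x) (p.2 x).

Lemma toCK p : ofC (toC p) = p. Proof. by case: p. Qed.

Lemma cL2_ofC f : cL2 f <-> pairL sL2 (ofC f).
Proof. by rewrite cL2P. Qed.

Lemma L2norm_ofC f : cL2 f -> cnorm f = pnorm (ofC f).
Proof.
move=> Lf; apply/eqP; rewrite -(@eqrXn2 _ 2)//; last 2 first.
- by rewrite fine_ge0// Lnorm_ge0.
- exact: seminorm_ge0.
by rewrite L2norm_normc// (sqr_pair_seminorm H)//; exact/cL2_ofC.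
Qed.

Lemma ofC_linear (c : R[i]) f g :
  ofC (c *: f + g) = cmul (complex.Re c) (complex.Im c) (ofC f) + ofC g.
Proof.
case: c => a b; congr pair; apply/funext => x;
  rewrite /ofC /cmul /= /GRing.scale /= !fctE /=; case: (f x) => u v; by case: (g x).
Qed.

Lemma ofC_resolvent (z : R[i]) f :
  ofC (z *: f - cP P f) = cmul (complex.Re z) (complex.Im z) (ofC f) - cap (sP P) (ofC f).
Proof. by rewrite ofC_linear. Qed.

Lemma ae_eq_ofC f g : cL2 f -> cL2 g -> (pnorm (ofC f - ofC g) = 0 <-> f = g %[ae pi]).
Proof.
move=> /cL2_ofC Lf /cL2_ofC Lg.
have [f1 f2] := Lf; have [g1 g2] := Lg.
have LB := sipB H2 Lf Lg.
split.
- move=> e.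
  have e1 : snorm ((ofC f).1 - (ofC g).1) = 0.
    apply/eqP; rewrite eq_le seminorm_ge0 andbT -e.
    exact: (pair_seminorm_fst H LB).
  have e2 : snorm ((ofC f).2 - (ofC g).2) = 0.
    apply/eqP; rewrite eq_le seminorm_ge0 andbT -e.
    exact: (pair_seminorm_snd H LB).
  move: e1 e2 => /(snorm_subr_eq0 f1 g1) e1 /(snorm_subr_eq0 f2 g2) e2.
  move: e1 e2; apply: filterS2 => x /= e1 e2 xT; move: (e1 xT) (e2 xT).
  by case: (f x) => ? ?; case: (g x) => ? ? /= -> ->.
- move=> e; apply/eqP; rewrite eq_le seminorm_ge0 andbT.
  apply: le_trans (pair_seminorm_le H LB) _.
  have -> : snorm (ofC f - ofC g).1 = 0.
    by apply/(snorm_subr_eq0 f1 g1); apply: filterS e => x /[apply] /= ->.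
  have -> : snorm (ofC f - ofC g).2 = 0.
    by apply/(snorm_subr_eq0 f2 g2); apply: filterS e => x /[apply] /= ->.
  by rewrite addr0.
Qed.

Lemma resolvent_set (r : R) (z : R[i]) : 0 <= r ->
  (forall f, sL20 f -> snorm (sP P f) <= r * snorm f) ->
  r < Normc.normc z -> z != 1 ->
  exists S, is_bounded_inverse pi cL2 cnorm (fun f => z *: f - cP P f) S.
Proof.
move=> r0 Hr rz z1.
have L1 := sL2_cst pi 1.
have ip1 : sdot (cst 1) (cst 1) = 1.
  by rewrite -(sqr_seminorm H L1) snorm_cst1 expr1n.
have ab1 : (complex.Re z, complex.Im z) <> (1, 0).
  by move=> [e1 e2]; move: z1; case: z e1 e2 {rz} => /= a b -> ->; rewrite eqxx.
have rab : r < Num.sqrt (complex.Re z ^+ 2 + complex.Im z ^+ 2) by case: z rz {z1 ab1}.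
have [S [K HS]] := resolvent_exists H HP L1 (sP_cst P 1) ip1 r0
  (deflate_sP_le r0 Hr) rab ab1 (@sL2_complete _ _ _ pi).
pose S' f := toC (S (ofC f)).
have LS f : cL2 f -> cL2 (S' f).
  by move=> /cL2_ofC Lf; apply/cL2_ofC; rewrite /S' toCK; case: (HS _ Lf).
have LQ f : cL2 f -> cL2 (z *: f - cP P f).
  move=> /cL2_ofC Lf; apply/cL2_ofC; rewrite ofC_resolvent.
  apply: (sipB H2); first exact: (cmul_pairL H).
  by case: Lf => ? ?; split; apply: HP.1.
have Llin c f g : cL2 f -> cL2 g -> cL2 (c *: f + g).
  move=> /cL2_ofC Lf /cL2_ofC Lg; apply/cL2_ofC; rewrite ofC_linear.
  by apply: (sipD H2) => //; exact: (cmul_pairL H).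
exists S'; split; [split|].
- exact: LS.
- move=> c f g Lf Lg; apply/ae_eq_ofC; [by apply: LS; exact: Llin|by apply: Llin; exact: LS|].
  have [_ _ _ _ lin] := HS _ ((cL2_ofC f).1 Lf).
  rewrite ofC_linear /S' !toCK ofC_linear; apply: lin; exact/cL2_ofC.
- exists K => f Lf; rewrite !L2norm_ofC//; last exact: LS.
  by rewrite /S' toCK; case: (HS _ ((cL2_ofC f).1 Lf)).
- move=> f Lf; have [_ _ s1 s2 _] := HS _ ((cL2_ofC f).1 Lf); split.
  + apply/ae_eq_ofC => //; first by apply: LS; exact: LQ.
    by rewrite /S' toCK ofC_resolvent.
  + apply/ae_eq_ofC => //; first by apply: LQ; exact: LS.
    by rewrite ofC_resolvent /S' toCK.
Qed.

End spectrum.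

(** * The spectral gap as a contraction constant *)

Section spectral_gap.
Context {R : realType} {dT : measure_display} {T : measurableType dT}.
Variables (P : R.-pker T ~> T) (pi : probability T R).
Local Notation sL2 := (sL2 pi).
Local Notation sL20 := (sL20 pi).
Local Notation sdot := (sdot pi).
Local Notation snorm := (seminorm_of sdot).
Local Notation cL2 := (cL2 pi).
Local Notation cnorm := (L2norm pi (@Normc.normc R)).
Let H := sL2_sip pi.

Hypothesis HP : selfadjoint sL2 sdot (sP P).

(** The centered part [h] of a fixed function is fixed too, so [‖h‖ <= r ‖h‖] with [r < 1] and [h]
    vanishes almost everywhere. This excludes the case where the gap is 0 by convention. *)
Lemma multiplicity_one (r : R) : r < 1 ->
  (forall f, sL20 f -> snorm (sP P f) <= r * snorm f) -> one_multiplicity_one P pi.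
Proof.
move=> r1 Hr.
have fixed f : sL2 f -> sP P f = f %[ae pi] -> f = cst (mean pi f) %[ae pi].
  move=> Lf fixf; have Lc := sL20_center Lf; have [Lh _] := Lc.
  have L1 := sL2_cst pi (mean pi f).
  apply/(snorm_subr_eq0 Lf L1).
  set h := f - _ in Lc Lh *.
  have e : snorm (sP P h - h) = 0.
    have ce : cst (mean pi f) = mean pi f *: cst 1 :> (T -> R).
      by apply/funext => x; rewrite /= -[LHS]mulr1.
    have hE : h = (- mean pi f) *: cst 1 + f by rewrite /h ce addrC scaleNr.
    have L2 : sL2 ((- mean pi f) *: sP P (cst 1) + sP P f).
      by apply: (sipPl H); apply: HP.1 => //; exact: sL2_cst.
    have LQ := HP.1 _ Lh.
    apply/eqP; rewrite eq_le seminorm_ge0 andbT.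
    apply: le_trans (seminorm_triangle H LQ L2 Lh) _.
    rewrite {1}hE (selfadjoint_linear H HP)//; last exact: sL2_cst.
    rewrite add0r hE sP_cst opprD addrACA subrr add0r.
    by rewrite (snorm_subr_eq0 (HP.1 _ Lf) Lf).2.
  have := Hr _ Lc; rewrite (seminorm_eq H (HP.1 _ Lh) Lh e) => h1.
  have h0 := seminorm_ge0 (ip := sdot) h.
  by apply/eqP; rewrite eq_le h0 andbT; nra.
have c1 : cL2 (cst 1) by apply/cL2P; split; exact: sL2_cst.
exists (cst 1); split => //.
- apply: aeW => x _; rewrite /cP /=.
  by rewrite -/(sP P (cst 1) x) -/(sP P (cst 0) x) !sP_cst.
- move=> [N [mN N0 sub]].
  have : pi setT = 0%E.
    apply/eqP; rewrite eq_le measure_ge0 andbT -N0 le_measure ?inE//.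
    by move=> x _; apply: sub => /= /(_ I) /eqP; rewrite oner_eq0.
  by rewrite probability_setT => /eqP; rewrite onee_eq0.
- move=> g /cL2P[Lr Li] fixg.
  exists (Complex (mean pi (fun x => complex.Re (g x))) (mean pi (fun x => complex.Im (g x)))).
  have e1 : sP P (fun x => complex.Re (g x)) = (fun x => complex.Re (g x)) %[ae pi].
    by apply: filterS fixg => x /[apply] <-.
  have e2 : sP P (fun x => complex.Im (g x)) = (fun x => complex.Im (g x)) %[ae pi].
    by apply: filterS fixg => x /[apply] <-.
  move: (fixed _ Lr e1) (fixed _ Li e2); apply: filterS2 => x h1 h2 xT.
  have sc (c : R[i]) : (c *: (cst 1 : T -> R[i])) x = c by exact: mulr1.
  rewrite sc.
  by move: (h1 xT) (h2 xT); case: (g x) => u v /= -> ->.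
Qed.

(** For a real scalar [M] the operator preserves real functions, so the bound on the complex inverse
    restricts to them. *)
Lemma not_Spec_bounded_below (M : R) : M != 0 -> ~ Spec P pi (Complex M 0) ->
  exists2 K, 0 < K & forall f, sL2 f -> snorm f <= K * snorm (M *: f - sP P f).
Proof.
move=> M0 nS.
have [S [[LS _ [K HK]] HS]] : exists S, is_bounded_inverse pi cL2 cnorm
    (fun f => Complex M 0 *: f - cP P f) S.
  apply: contrapT => nex; apply: nS; split => //.
  by apply/eqP => -[] /eqP; rewrite (negbTE M0).
(* The bound of an inverse may come with a nonpositive constant, whereas a positive one is
   wanted. *)
exists (Num.max K 1); first by rewrite lt_max ltr01 orbT.
move=> f Lf.
pose F x := Complex (f x) 0.
have LF : cL2 F by apply/cL2P; split => //; exact: (sL2_cst pi 0).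
pose G := Complex M 0 *: F - cP P F.
have Gre : (fun x => complex.Re (G x)) = M *: f - sP P f.
  apply/funext => x; rewrite /G /= /GRing.scale /= /cP /=.
  by rewrite mul0r subr0.
have Gim : (fun x => complex.Im (G x)) = cst 0.
  apply/funext => x; rewrite /G /= /GRing.scale /= /cP /=.
  by rewrite -/(sP P (cst 0) x) sP_cst/= mul0r mulr0 addr0 subr0.
have LB : sL2 (M *: f - sP P f).
  by apply: (sipB H); [exact: (sipZ H)|exact: HP.1].
have LG : cL2 G by apply/cL2P; rewrite Gre Gim; split => //; exact: sL2_cst.
have [SF _] := HS _ LF.
have nF h : cL2 h -> cnorm h = Num.sqrt (snorm (fun x => complex.Re (h x)) ^+ 2 +
    snorm (fun x => complex.Im (h x)) ^+ 2).
  move=> Lh; rewrite -L2norm_normc// sqrtr_sqr ger0_norm//.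
  by rewrite fine_ge0// Lnorm_ge0.
have n0 : snorm (cst 0) = 0.
  by apply/(snorm_eq0 (sL2_cst pi 0)); exact: aeW.
have nSF : cnorm (S G) = snorm f.
  have LSG := LS _ LG.
  rewrite L2norm_ofC//; have := (ae_eq_ofC LSG LF).2 SF.
  have pL := pair_sip H.
  move=> /(seminorm_eq pL ((cL2_ofC pi _).1 LSG) ((cL2_ofC pi _).1 LF)) ->.
  rewrite -L2norm_ofC// nF//= n0 expr0n addr0 sqrtr_sqr ger0_norm//.
  exact: seminorm_ge0.
have nG : cnorm G = snorm (M *: f - sP P f).
  rewrite nF// Gre Gim n0 expr0n addr0 sqrtr_sqr ger0_norm//.
  exact: seminorm_ge0.
rewrite -nSF -nG; apply: le_trans (HK _ LG) _.
rewrite ler_wpM2r//; first by rewrite nG seminorm_ge0.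
by rewrite le_max lexx.
Qed.

Lemma spectral_gap_contraction : uniformly_ergodic P pi ->
  0 < spectral_gap P pi <= 1 /\
  forall f, sL20 f -> snorm (sP P f) <= (1 - spectral_gap P pi) * snorm f.
Proof.
move=> erg; have [r /andP[r0 r1] Hr] := sP_contraction HP erg.
rewrite /spectral_gap asboolT; last exact: multiplicity_one Hr.
set E := [set _ | _ in _]; rewrite opprB addrCA subrr addr0.
have Er x : E x -> 0 <= x <= r.
  move=> [z [[z0 nz] z1] <-]; apply/andP; split.
    by case: (z) => u v; exact: sqrtr_ge0.
  rewrite leNgt; apply/negP => rz; apply: nz.
  exact: (resolvent_set HP (ltW r0) Hr rz z1).
have ubE : ubound E r by move=> x /Er /andP[].
have E0 : 0 <= sup E.
  (* The supremum of the empty set is 0 here, in accordance with the convention for the gap. *)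
  have [->|/set0P[x Ex]] := eqVneq E set0; first by rewrite sup0.
  have /andP[x0 _] := Er x Ex.
  by apply: le_trans x0 _; apply: ub_le_sup => //; exists r.
have Er' : sup E <= r.
  have [->|/set0P En0] := eqVneq E set0; first by rewrite sup0 ltW.
  exact: ge_sup.
split; first by apply/andP; split; lra.
have H0 := sL20_sip pi.
(* The admissible contraction constants on mean-zero functions; their infimum is the operator norm,
   and [Binf] says that it is attained. *)
pose B := [set M : R | 0 <= M /\ forall f, sL20 f -> snorm (sP P f) <= M * snorm f].
have Br : B r by split => //; exact: ltW.
have lbB : has_lbound B by exists 0 => M [].
have infB0 : 0 <= inf B by apply: lb_le_inf; [exists r|move=> M []].
have Binf : B (inf B).
  split => // f Lf; have [f0|f0] := eqVneq (snorm f) 0.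
    by have := Hr _ Lf; rewrite f0 !mulr0.
  have {}f0 : 0 < snorm f by rewrite lt_def f0 seminorm_ge0.
  rewrite -ler_pdivrMr//; apply: lb_le_inf; first by exists r.
  by move=> M [_ /(_ _ Lf)]; rewrite ler_pdivrMr.
(* If the norm exceeded [sup E], then neither [inf B] nor [- inf B] would lie in the spectrum: both
   have modulus above [sup E] and, being at most [r < 1] in modulus, differ from 1. The improved
   bound would then be an element of [B] below its infimum. *)
have [|lt] := leP (inf B) (sup E).
  move=> le f Lf; apply: le_trans (Binf.2 _ Lf) _.
  by rewrite ler_wpM2r// seminorm_ge0.
have M0 : 0 < inf B by apply: le_lt_trans lt.
have Mr : inf B <= r by apply: ge_inf.
have nSpec (M : R) : `|M| = inf B -> ~ Spec P pi (Complex M 0).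
  move=> MB sM.
  have : E `|M|.
    exists (Complex M 0); last by rewrite /= expr0n addr0 sqrtr_sqr.
    split => //=; apply/eqP => -[] M1.
    by move: MB Mr; rewrite M1 normr1 => <-; rewrite leNgt r1.
  move=> /(ub_le_sup (ex_intro _ r ubE)).
  by rewrite MB leNgt lt.
have Mn0 : inf B != 0 by rewrite gt_eqF.
have [K1 K10 HK1] := not_Spec_bounded_below Mn0 (nSpec _ (gtr0_norm M0)).
have [||K2 K20 HK2] := @not_Spec_bounded_below (- inf B).
- by rewrite oppr_eq0.
- by apply: nSpec; rewrite normrN gtr0_norm.
pose K := Num.max K1 K2.
have K0 : 0 < K by rewrite lt_max K10.
have [||M' [M'0 M'lt HM']] := selfadjoint_improve_bound H0 (sL20_selfadjoint HP) M0 K0 Binf.2.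
- move=> f [Lf _]; apply: le_trans (HK1 _ Lf) _.
  by rewrite ler_wpM2r ?seminorm_ge0// le_max lexx.
- move=> f [Lf _]; apply: le_trans (HK2 _ Lf) _.
  by rewrite ler_wpM2r ?seminorm_ge0// le_max lexx orbT.
have : inf B <= M' by apply: ge_inf.
by rewrite leNgt M'lt.
Qed.

End spectral_gap.

(** * Bias coefficients *)

Section euclidean.
Context {R : realType} {d : nat}.
Implicit Types (u v : 'cV[R]_d) (M : 'M[R]_d).

Definition edot u v : R := \sum_(i < d) u i 0 * v i 0.

Lemma edot_sip : semi_inner_product (@setT 'cV[R]_d) edot.
Proof.
split => //.
- by move=> u v; apply: eq_bigr => i _; rewrite mulrC.
- move=> a u v w _ _ _; rewrite mulr_sumr -big_split/=; apply: eq_bigr => i _.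
  by rewrite !mxE mulrDl mulrA.
- by move=> u _; apply: sumr_ge0 => i _; rewrite -expr2 sqr_ge0.
Qed.

Lemma enormE v : enorm v = seminorm_of edot v.
Proof. by congr Num.sqrt; apply: eq_bigr => i _; rewrite expr2. Qed.

Lemma sqr_enorm v : enorm v ^+ 2 = \sum_(i < d) v i 0 ^+ 2.
Proof. by rewrite sqr_sqrtr// sumr_ge0// => i _; rewrite sqr_ge0. Qed.

Lemma enorm_ge0 v : 0 <= enorm v. Proof. exact: sqrtr_ge0. Qed.

Lemma enormD u v : enorm (u + v) <= enorm u + enorm v.
Proof. by rewrite !enormE; apply: (seminormD edot_sip). Qed.

Lemma enormZ a v : enorm (a *: v) = `|a| * enorm v.
Proof. by rewrite !enormE (seminormZ edot_sip). Qed.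

Lemma enorm_eq0 v : enorm v = 0 -> v = 0.
Proof.
move=> v0; apply/colP => i; rewrite mxE; apply/eqP; rewrite -sqrf_eq0.
have : enorm v ^+ 2 == 0 by rewrite v0 expr0n.
rewrite sqr_enorm psumr_eq0; last by move=> j _; exact: sqr_ge0.
by move=> /allP /(_ i); apply; rewrite mem_index_enum.
Qed.

(** The constant is the Frobenius norm, by Cauchy-Schwarz on each row. It also shows that the
    supremum defining [specnorm] is over a bounded set. *)
Lemma enorm_mulmx_bounded M : exists2 K, 0 <= K & forall v, enorm (M *m v) <= K * enorm v.
Proof.
pose K2 := \sum_(i < d) enorm (row i M)^T ^+ 2.
have K20 : 0 <= K2 by apply: sumr_ge0 => i _; exact: sqr_ge0.
exists (Num.sqrt K2); first exact: sqrtr_ge0.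
move=> v; rewrite -(@ler_pXn2r _ 2) ?nnegrE ?mulr_ge0 ?sqrtr_ge0 ?enorm_ge0//.
rewrite exprMn (sqr_sqrtr K20) sqr_enorm mulr_suml; apply: ler_sum => i _.
have -> : (M *m v) i 0 = edot (row i M)^T v.
  by rewrite mxE; apply: eq_bigr => j _; rewrite !mxE.
rewrite -exprMn -[leLHS]real_normK ?num_real// lerXn2r ?nnegrE ?mulr_ge0 ?enorm_ge0//.
rewrite !enormE; exact: (cauchy_schwarz edot_sip).
Qed.

Lemma enorm_mulmx_le M v : enorm (M *m v) <= specnorm M * enorm v.
Proof.
have [K K0 HK] := enorm_mulmx_bounded M.
have ub : has_ubound [set enorm (M *m v) | v in [set v : 'cV[R]_d | enorm v <= 1]].
  exists K => _ [w /= w1 <-]; apply: le_trans (HK w) _.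
  by rewrite ler_piMr.
have [v0|v0] := eqVneq (enorm v) 0.
  by rewrite (enorm_eq0 v0) mulmx0 -(enorm_eq0 v0) v0 mulr0.
have vp : 0 < enorm v by rewrite lt_def v0 enorm_ge0.
have -> : M *m v = enorm v *: (M *m ((enorm v)^-1 *: v)).
  by rewrite -scalemxAr scalerA divff// scale1r.
rewrite enormZ ger0_norm ?enorm_ge0// mulrC ler_pM2r//.
apply: ub_le_sup => //; exists ((enorm v)^-1 *: v) => //=.
by rewrite enormZ ger0_norm ?invr_ge0 ?enorm_ge0// mulVf.
Qed.

(** A singular matrix has the eigenvalue 0, whose real part is not negative. *)
Lemma hurwitz_unitmx M : hurwitz M -> M \in unitmx.
Proof.
move=> hM; apply/negPn/negP => nu.
have : eigenvalue (map_mx (real_complex R) M) 0.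
  rewrite /eigenvalue /eigenspace raddf0 subr0 kermx_eq0.
  by rewrite row_free_unit map_unitmx.
by move=> /hM; rewrite ltxx.
Qed.

End euclidean.

Section vector_estimates.
Context {R : realType} {dT : measure_display} {T : measurableType dT} {d : nat}.
Variable pi : probability T R.
Local Notation sL2 := (sL2 pi).
Local Notation sdot := (sdot pi).
Local Notation snorm := (seminorm_of sdot).
Local Notation vL2 := (vL2 (d := d) pi).
Local Notation vnorm := (seminorm_of (@vdot R dT T d pi)).
Let H := sL2_sip pi.
Let HV := @vL2_sip R dT T pi d.
Implicit Types f g : T -> 'cV[R]_d.

Lemma sqr_vnorm f : vL2 f -> vnorm f ^+ 2 = \sum_(i < d) snorm (vcoord f i) ^+ 2.
Proof.
move=> Lf; rewrite (sqr_seminorm HV)// vdotE//; apply: eq_bigr => i _.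
by rewrite (sqr_seminorm H)//; move/vL2P: Lf.
Qed.

Lemma vL2_dominated g (phi : T -> R) : vmeasurable g -> sL2 phi ->
  (forall x, enorm (g x) <= phi x) -> vL2 g /\ vnorm g <= snorm phi.
Proof.
move=> mg [mphi phi2] gphi.
have gphi2 x : enorm (g x) ^+ 2 <= phi x ^+ 2.
  by rewrite lerXn2r ?nnegrE ?enorm_ge0// (le_trans (enorm_ge0 _) (gphi x)).
have Lg : vL2 g.
  apply/vL2P => i; split; first exact: mg.
  apply: le_integrable phi2 => //.
    by apply/measurable_EFinP; apply: measurable_funX; exact: mg.
  move=> x _; rewrite /= lee_fin !ger0_norm ?sqr_ge0//.
  apply: le_trans (gphi2 x); rewrite sqr_enorm (bigD1 i)//= lerDl.
  by apply: sumr_ge0 => j _; exact: sqr_ge0.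
split => //; apply: (le_seminorm HV) => //; first exact: seminorm_ge0.
rewrite (sqr_seminorm H)//.
rewrite /vdot /sdot.
apply: le_Rintegral => //.
- have := @integrable_sum _ _ _ pi _ measurableT _ (index_enum 'I_d) predT
    (fun i x => (g x i 0 * g x i 0)%:E)
    (fun i _ => sL2_integrableM ((vL2P pi g).1 Lg i) ((vL2P pi g).1 Lg i)).
  by apply: eq_integrable => // x _; rewrite /= sumEFin.
- move=> x _; apply: le_trans (gphi2 x); rewrite sqr_enorm.
  by apply: ler_sum => i _; rewrite expr2.
Qed.

Lemma enorm_sL2 f : vL2 f -> sL2 (fun x => enorm (f x)) /\
  snorm (fun x => enorm (f x)) = vnorm f.
Proof.
move=> Lf; have [mf ff] := Lf.
have men : measurable_fun setT (fun x => enorm (f x)).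
  rewrite (_ : (fun x => _) = (fun x => (\sum_(i < d) f x i 0 ^+ 2) `^ 2^-1)).
    apply: (measurableT_comp (measurable_powR _)).
    by apply: measurable_sum => i; apply: measurable_funX; exact: mf.
  by apply/funext => x; rewrite powR12_sqrt// sumr_ge0// => i _; rewrite sqr_ge0.
have Le : sL2 (fun x => enorm (f x)) by apply/finite_norm2P.
by split => //; rewrite -fine_Lnorm2// -L2norm_vdot.
Qed.

Lemma vL2_scaled g f k : vmeasurable g -> vL2 f -> 0 <= k ->
  (forall x, enorm (g x) <= k * enorm (f x)) -> vL2 g /\ vnorm g <= k * vnorm f.
Proof.
move=> mg Lf k0 gf; have [Le <-] := enorm_sL2 Lf.
have <- : snorm (k *: (fun x => enorm (f x))) = k * snorm (fun x => enorm (f x)).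
  by rewrite (seminormZ H)// ger0_norm.
by apply: vL2_dominated => //; exact: (sipZ H).
Qed.

Lemma vL2_bounded g k : vmeasurable g -> 0 <= k -> (forall x, enorm (g x) <= k) ->
  vL2 g /\ vnorm g <= k.
Proof.
move=> mg k0 gk; have [Lg gn] := vL2_dominated mg (sL2_cst pi k) gk.
split => //; apply: le_trans gn _.
by apply: snorm_le_bound => // x; rewrite ger0_norm.
Qed.

Lemma vnorm_ae_eq f g : vL2 f -> vL2 g -> f = g %[ae pi] -> vnorm (f - g) = 0.
Proof.
move=> Lf Lg fg; apply/eqP; rewrite -sqrf_eq0.
rewrite sqr_vnorm; last exact: (sipB HV).
rewrite big1// => i _.
rewrite (_ : vcoord _ i = vcoord f i - vcoord g i); last first.
  by apply/funext => x; rewrite /vcoord /= !mxE.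
move: Lf Lg => /vL2P Lf /vL2P Lg.
rewrite (snorm_subr_eq0 (Lf i) (Lg i)).2 ?expr0n//.
by apply: filterS fg => x /[apply] fg; rewrite /vcoord fg.
Qed.

Lemma enorm_vmean_le f : vL2 f -> enorm (vmean pi f) <= vnorm f.
Proof.
move=> Lf; rewrite -(@ler_pXn2r _ 2) ?nnegrE ?seminorm_ge0 ?enorm_ge0//.
rewrite sqr_enorm sqr_vnorm//; apply: ler_sum => i _.
rewrite mxE -[leLHS]real_normK ?num_real// lerXn2r ?nnegrE ?seminorm_ge0//.
by apply: norm_mean_le; move/vL2P: Lf; apply.
Qed.

Lemma vPi_L2 f : vL2 f -> vL2 (vPi pi f) /\ vnorm (vPi pi f) <= vnorm f.
Proof.
move=> Lf.
have [||//|L n] := @vL2_bounded (vPi pi f) (enorm (vmean pi f)).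
- by move=> i; exact: measurable_cst.
- exact: enorm_ge0.
- by split => //; apply: le_trans n _; exact: enorm_vmean_le.
Qed.

Lemma vmeasurable_mulmx (M : T -> 'M[R]_d) f : mmeasurable M -> vmeasurable f ->
  vmeasurable (fun x => M x *m f x).
Proof.
move=> mM mf i.
rewrite (_ : (fun x => _) = (fun x => \sum_(j < d) M x i j * f x j 0)); last first.
  by apply/funext => x; rewrite mxE.
by apply: measurable_sum => j; apply: measurable_funM; [exact: mM|exact: mf].
Qed.

End vector_estimates.

(** * Reversibility, resolvent bounds and the coefficients *)

Section bias.
Context {R : realType} {dT : measure_display} {T : measurableType dT} {d : nat}.
Variables (P : R.-pker T ~> T) (pi : probability T R).
Local Notation sL2 := (sL2 pi).
Local Notation sdot := (sdot pi).
Local Notation snorm := (seminorm_of sdot).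
Local Notation vL2 := (vL2 (d := d) pi).
Local Notation vnorm := (seminorm_of (@vdot R dT T d pi)).
Local Notation vPadj := (@vPadj R dT T d P pi).
Let H := sL2_sip pi.
Let HV := @vL2_sip R dT T pi d.
Implicit Types f g : T -> 'cV[R]_d.

Hypothesis rev : @reversible R dT T d P pi.

Lemma vcoord_vP f i : vcoord (vP P f) i = sP P (vcoord f i).
Proof. by apply/funext => x; rewrite /vcoord /vP /vmean mxE. Qed.

(** Reversibility is stated for vector functions. A scalar function embeds as a vector with equal
    coordinates, which multiplies inner products by [d]; a positive [d] cancels. *)
Lemma reversible_selfadjoint : (0 < d)%N -> selfadjoint sL2 sdot (sP P).
Proof.
move=> d0; have [PL Psym] := rev.
pose E (f : T -> R) : T -> 'cV[R]_d := fun x => const_mx (f x).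
have cE (h : T -> R) i : vcoord (E h) i = h by apply/funext => x; rewrite /vcoord mxE.
have LE (h : T -> R) : sL2 h -> vL2 (E h) by move=> Lf; apply/vL2P => i; rewrite cE.
have PE (h : T -> R) : sL2 h -> sL2 (sP P h).
  move=> /LE/PL/vL2P /(_ (Ordinal d0)).
  by rewrite vcoord_vP cE.
split => // f g Lf Lg.
have := Psym _ _ (LE _ Lf) (LE _ Lg).
rewrite !vdotE; try by [apply: PL; exact: LE|exact: LE].
under eq_bigr do rewrite vcoord_vP !cE.
under [RHS]eq_bigr do rewrite vcoord_vP !cE.
rewrite !sumr_const card_ord -[LHS]mulr_natr -[RHS]mulr_natr.
by move=> /mulIf; apply; rewrite pnatr_eq0 -lt0n.
Qed.

Lemma vPadj_adjoint : is_adjoint vL2 (vdot pi) (vP P) vPadj.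
Proof.
rewrite /Defs.vPadj /adjoint; set J := [set _ | _].
have : J (xget (id : (T -> 'cV[R]_d) -> (T -> 'cV[R]_d)) J).
  by apply: xgetPex; exists (vP P); exact: rev.
by [].
Qed.

(** [vPadj] is one adjoint picked by choice and [vP] is another; their difference is orthogonal to
    everything, hence of seminorm 0. *)
Lemma vPadjE f : vL2 f -> vnorm (vPadj f - vP P f) = 0.
Proof.
move=> Lf; have [PL Psym] := rev; have [AL Asym] := vPadj_adjoint.
have LA := AL _ Lf; have LP := PL _ Lf; have LB := sipB HV LA LP.
rewrite /seminorm_of (ipBr HV LA LP LB) -Asym// -Psym// subrr sqrtr0//.
Qed.

Section contraction.
Variable rho : R.
Hypotheses (d0 : (0 < d)%N) (rho0 : 0 <= rho) (rho1 : rho < 1).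
Hypothesis Prho : forall h, sL20 pi h -> snorm (sP P h) <= rho * snorm h.

(** After replacing P^* by P, each coordinate is the deflated scalar operator, so the scalar bound
    passes to the sum of squares with no factor depending on [d]. *)
Lemma centered_vPadj_le f : vL2 f -> vnorm (vPadj f - vPi pi f) <= rho * vnorm f.
Proof.
move=> Lf; have HP := reversible_selfadjoint d0.
have LP := rev.1 _ Lf; have LA := vPadj_adjoint.1 _ Lf; have [Lpi _] := vPi_L2 Lf.
have -> : vnorm (vPadj f - vPi pi f) = vnorm (vP P f - vPi pi f).
  apply: (seminorm_eq HV); try exact: (sipB HV).
  by rewrite opprB addrA subrK vPadjE.
have LB := sipB HV LP Lpi.
apply: (le_seminorm HV) => //; first by rewrite mulr_ge0 ?seminorm_ge0.
rewrite -(sqr_seminorm HV)// exprMn !sqr_vnorm// mulr_sumr.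
apply: ler_sum => i _; rewrite -exprMn lerXn2r ?nnegrE ?mulr_ge0 ?seminorm_ge0//.
have Li := (vL2P pi f).1 Lf i.
suff -> : vcoord (vP P f - vPi pi f) i = deflate sdot (sP P) (cst 1) (vcoord f i).
  exact: deflate_sP_le.
rewrite /deflate -meanE -vcoord_vP; apply/funext => x.
rewrite /vcoord !fctE /= !mxE; congr (_ - _).
exact/esym/mulr1.
Qed.

(* If there were no inverse, [bounded_inverse] would be the identity, for which
   the same estimate holds. *)
Lemma resolvent_le f : vL2 f -> vL2 (resolvent P pi f) /\
  vnorm (resolvent P pi f) <= rho / (1 - rho) * vnorm f.
Proof.
move=> Lf.
have g0 : 0 < 1 - rho by rewrite subr_gt0.
have Lc g : vL2 g -> vL2 (vPadj g - vPi pi g).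
  by move=> Lg; apply: (sipB HV); [exact: vPadj_adjoint.1|exact: (vPi_L2 Lg).1].
rewrite /resolvent /bounded_inverse; set w := vPadj f - vPi pi f.
have Lw : vL2 w := Lc _ Lf.
have wn : vnorm w <= rho * vnorm f := centered_vPadj_le Lf.
set J := [set S | _].
have [[S0 JS0]|nJ] := pselect (exists S, J S); last first.
  rewrite xgetPN; last by move=> S JS; apply: nJ; exists S.
  split => //; apply: le_trans wn _.
  rewrite ler_wpM2r ?seminorm_ge0// ler_peMr// invf_ge1//.
  by rewrite gerBl.
set S := xget _ J.
have [[SL _ _] SJ] : J S by apply: xgetPex; exists S0.
have [_ Sw] := SJ _ Lw; have LS := SL _ Lw.
split => //.
have Lcs := Lc _ LS; have LB := sipB HV LS Lcs.
have eB : S w - vPadj (S w) + vPi pi (S w) = S w - (vPadj (S w) - vPi pi (S w)).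
  by rewrite opprB addrA addrAC.
rewrite eB in Sw.
(* From [S w = w + (P^* - Pi) (S w)]: the last term has norm at most [rho ‖S w‖] and is absorbed,
   leaving [(1 - rho) ‖S w‖ <= ‖w‖ <= rho ‖f‖]. *)
have : vnorm (S w) <= vnorm w + vnorm (vPadj (S w) - vPi pi (S w)).
  rewrite -(seminorm_eq HV LB Lw (vnorm_ae_eq LB Lw Sw)).
  rewrite -{1}(subrK (vPadj (S w) - vPi pi (S w)) (S w)).
  exact: (seminormD HV).
rewrite mulrAC ler_pdivlMr// => h.
rewrite mulrBr mulr1 lerBlDr; apply: le_trans h _; apply: lerD => //.
by rewrite mulrC; exact: centered_vPadj_le.
Qed.

End contraction.

End bias.

(** With [t = rho / (1 - rho)], [upsilon] costs [t (‖theta‖ + c)], each [Xi] costs [t (1 + K)] and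
    the final [Dbar] costs [K], so [t] occurs exactly [i.+1] times. The summands 1 make both
    constant factors at least 1, so raising them to the power [i.+1] only enlarges the bound. *)
Lemma enorm_Bcoef_le (R : realType) (dT : measure_display) (T : measurableType dT)
    (d : nat) (P : R.-pker T ~> T) (pi : probability T R)
    (A : T -> 'M[R]_d) (b : T -> 'cV[R]_d) (theta : 'cV[R]_d) (K c rho : R) (i : nat) :
  (0 < d)%N -> mmeasurable A -> vmeasurable b ->
  @reversible R dT T d P pi ->
  0 <= rho < 1 ->
  (forall f, sL20 pi f ->
    seminorm_of (sdot pi) (sP P f) <= rho * seminorm_of (sdot pi) f) ->
  (forall x v, enorm (A x *m v) <= enorm v) ->
  0 <= K -> (forall v, enorm (invmx (mmean A pi) *m v) <= K * enorm v) ->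
  0 <= c -> (forall x, enorm (b x) <= c) ->
  enorm (Bcoef P pi A b theta i.+1) <=
    ((1 + K) * (1 + enorm theta + c) * (rho / (1 - rho))) ^+ i.+1.
Proof.
move=> d0 mA mb rev /andP[rho0 rho1] Prho A1 K0 HK c0 bc.
have HV := @vL2_sip R dT T pi d.
set vnorm := seminorm_of (@vdot R dT T d pi).
pose t := rho / (1 - rho).
have t0 : 0 <= t by rewrite divr_ge0// subr_ge0 ltW.
have th0 := enorm_ge0 theta.
have Dn f : vL2 pi f -> vL2 pi (Dop A f) /\ vnorm (Dop A f) <= vnorm f.
  move=> Lf; rewrite -[leRHS]mul1r; apply: vL2_scaled => //.
    by apply: vmeasurable_mulmx => //; case: Lf.
  by move=> x; rewrite mul1r; exact: A1.
have Dbn f : vL2 pi f -> vL2 pi (Dbar pi A f) /\ vnorm (Dbar pi A f) <= K * vnorm f.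
  move=> Lf; apply: vL2_scaled => //.
    apply: (vmeasurable_mulmx (M := fun=> invmx (mmean A pi))).
      by move=> k l; exact: measurable_cst.
    by apply: vmeasurable_mulmx => //; case: Lf.
  by move=> x; apply: le_trans (HK _) _; rewrite ler_wpM2l.
have Xin f : vL2 pi f -> vL2 pi (Xi P pi A f) /\
    vnorm (Xi P pi A f) <= t * (1 + K) * vnorm f.
  move=> Lf; have [LD Dle] := Dbn _ Lf; have [Lpi pile] := vPi_L2 LD.
  have LB := sipB HV Lf Lpi; have [LE Ele] := Dn _ LB.
  have [LX Xle] := resolvent_le rev d0 rho0 rho1 Prho LE.
  split => //; apply: le_trans Xle _; rewrite -[leRHS]mulrA ler_wpM2l//.
  apply: le_trans Ele _; apply: le_trans (seminormB HV Lf Lpi) _.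
  by rewrite mulrDl mul1r lerD2l; apply: le_trans pile Dle.
have [Lu un] : vL2 pi (upsilon P pi A b theta) /\
    vnorm (upsilon P pi A b theta) <= t * (enorm theta + c).
  have [|||Ls sn] := @vL2_bounded R dT T d pi (fun x => A x *m theta + b x) (enorm theta + c).
  - move=> k; rewrite (_ : (fun x => _) = (fun x => (A x *m theta) k 0 + b x k 0)).
      apply: measurable_funD; last exact: mb.
      by apply: (vmeasurable_mulmx (f := fun=> theta)) => // l; exact: measurable_cst.
    by apply/funext => x; rewrite mxE.
  - exact: addr_ge0.
  - by move=> x; apply: le_trans (enormD _ _) _; apply: lerD.
  have [LX Xle] := resolvent_le rev d0 rho0 rho1 Prho Ls.
  by split => //; apply: le_trans Xle _; rewrite ler_wpM2l.
have [Li itn] : vL2 pi (iter i (Xi P pi A) (upsilon P pi A b theta)) /\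
    vnorm (iter i (Xi P pi A) (upsilon P pi A b theta)) <=
      (t * (1 + K)) ^+ i * (t * (enorm theta + c)).
  elim: i => [|i [Li itn]]; first by rewrite expr0 mul1r.
  have [LX Xle] := Xin _ Li; split => //=.
  apply: le_trans Xle _; rewrite exprS -[leRHS]mulrA ler_wpM2l//.
  by rewrite mulr_ge0// addr_ge0.
have [LD Dle] := Dbn _ Li.
rewrite /Bcoef /= -scaleN1r enormZ normrN1 mul1r.
apply: le_trans (enorm_vmean_le LD) _; apply: le_trans Dle _.
apply: (@le_trans _ _ (K * ((t * (1 + K)) ^+ i * (t * (enorm theta + c))))).
  by rewrite ler_wpM2l.
have -> : K * ((t * (1 + K)) ^+ i * (t * (enorm theta + c))) =
    K * (1 + K) ^+ i * (enorm theta + c) * t ^+ i.+1.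
  by rewrite exprMn exprS; ring.
rewrite [leRHS]exprMn ler_wpM2r ?exprn_ge0// exprMn; apply: ler_pM.
- by rewrite mulr_ge0// exprn_ge0// addr_ge0.
- exact: addr_ge0.
- by rewrite exprS ler_wpM2r ?exprn_ge0 ?addr_ge0// lerDr.
- rewrite -addrA; have s0 : 0 <= enorm theta + c by exact: addr_ge0.
  apply: (@le_trans _ _ (1 + (enorm theta + c))); first by rewrite lerDr.
  by rewrite exprS ler_peMr ?addr_ge0// exprn_ege1// lerDl.
Qed.

Theorem theorem4p4 (R : realType) (dT : measure_display) (T : measurableType dT)
    (d : nat) (A : T -> 'M[R]_d) (b : T -> 'cV[R]_d) (pi : probability T R)
    (d_gt0 : (0 < d)%N) (borelT : borel_space R T)
    (measA : mmeasurable A) (measb : vmeasurable b)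
    (Amax_le1 : (Amax A <= 1)%E) (bmax_fin : (bmax b < +oo)%E)
    (hurwitzA : hurwitz (mmean A pi)) :
  exists2 C : R, 0 < C &
  forall (P : R.-pker T ~> T),
    unique_stationary P pi ->
    uniformly_ergodic P pi ->
    @reversible R dT T d P pi ->
  forall (dO : measure_display) (Omega : measurableType dO)
    (Pr : probability Omega R) (X : nat -> {RV Pr >-> T}),
    is_markov_chain P pi X ->
  forall (Gamma : 'M[R]_d) (gmax : R),
    lyapunov (mmean A pi) Gamma ->
    max_eigenvalue Gamma gmax ->
  forall (alpha : R) (tau : nat),
    0 < alpha < 1 ->
    is_mixing_time A b P pi alpha tau ->
    alpha * tau%:R < (5 / 100) / (95 * gmax) ->
  forall (theta : 'cV[R]_d),
    mmean A pi *m theta + vmean pi b = 0 ->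
  forall (i : nat), (1 <= i)%N ->
    enorm (Bcoef P pi A b theta i) <=
      (C * ((1 - spectral_gap P pi) / spectral_gap P pi)) ^+ i.
Proof.
have [K K0 HK] := enorm_mulmx_bounded (invmx (mmean A pi)).
have A1 x v : enorm (A x *m v) <= enorm v.
  apply: le_trans (enorm_mulmx_le _ _) _; rewrite ler_piMl ?enorm_ge0//.
  rewrite -lee_fin; apply: le_trans Amax_le1.
  by apply: ereal_sup_ubound; exists x.
pose c := `|fine (bmax b)|.
have bc x : enorm (b x) <= c.
  have bx : ((enorm (b x))%:E <= bmax b)%E by apply: ereal_sup_ubound; exists x.
  apply: le_trans (ler_norm (fine (bmax b))); rewrite -lee_fin fineK//.
  by rewrite fin_numElt bmax_fin andbT (lt_le_trans _ bx)// ltNyr.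
(* The constant is fixed before [P] and [theta] are given, so the solution is written here in terms
   of [A], [b] and [pi]; invertibility of the mean matrix identifies it with [theta] later. *)
pose theta0 := - (invmx (mmean A pi) *m vmean pi b).
have th0 := enorm_ge0 theta0.
exists ((1 + K) * (1 + enorm theta0 + c)).
  rewrite -addrA; apply: mulr_gt0; apply: ltr_pwDl => //.
  by apply: addr_ge0 => //; exact: normr_ge0.
move=> P _ erg rev _ _ _ _ _ _ _ _ _ _ _ _ _ _ theta thetaE [//|i] _.
have -> : theta = theta0.
  have uA := hurwitz_unitmx hurwitzA.
  rewrite /theta0 -mulmxN; move/eqP: thetaE; rewrite addr_eq0 => /eqP <-.
  by rewrite mulKmx.
have HP := reversible_selfadjoint rev d_gt0.
have [/andP[g0 g1] Hr] := spectral_gap_contraction HP erg.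
(* With [rho = 1 - gamma], the factor [rho / (1 - rho)] becomes [(1 - gamma) / gamma]. *)
have rho01 : 0 <= 1 - spectral_gap P pi < 1 by apply/andP; split; lra.
have := enorm_Bcoef_le theta0 i d_gt0 measA measb rev rho01 Hr A1 K0 HK (normr_ge0 _) bc.
by rewrite opprB addrCA subrr addr0.
Qed.
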